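(* Let $f$ be a real-valued function of $d$-regular graphs and let $\delta>0$. 1. If Conjecture L (non-bipartite part) holds with non-respectful random noise $\mathcal{S}^{\mathrm{rand}}_\epsilon$, or with adversarial noise $\mathcal{S}^{\mathrm{adv}}_\epsilon$, then no polynomial-time algorithm certifies an upper bound of $M(f)-\delta$ on $f(G)$ with high probability when $G\sim\mathcal{G}(n,d)$. 2. If it holds with respectful random noise $\widetilde{\mathcal{S}}^{\mathrm{rand}}_\epsilon$ or respectful adversarial noise $\widetilde{\mathcal{S}}^{\mathrm{adv}}_\epsilon$, then no polynomial-time algorithm certifies an upper bound of $\widetilde M(f)-\delta$ on $f(G)$ with high probability when $G\sim\mathcal{G}(n,d)$. 3. If Conjecture L (bipartite part) holds with bipartite random noise $\mathcal{S}^{\mathrm{rand,bi}}_\epsilon$ or adversarial noise $\mathcal{S}^{\mathrm{adv}}_\epsilon$, then no polynomial-time algorithm certifies an upper bound of $M_{\mathrm{bi}}(f)-\delta$ on $f(G)$ with high probability when $G\sim\mathcal{G}((\frac n2,\frac n2),d)$. 4. If it holds with respectful bipartite random noise or respectful adversarial noise, then no polynomial-time algorithm certifies an upper bound of $\widetilde M_{\mathrm{bi}}(f)-\delta$ on $f(G)$ with high probability when $G\sim\mathcal{G}((\frac n2,\frac n2),d)$.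
   Context: Models: $\mathcal{G}(n,d)$ is uniform over simple $d$-regular graphs on $[n]$. $\mathcal{G}((\frac n2,\frac n2),d)$ is uniform over simple $d$-regular bipartite graphs with sides of size $n/2$. For a $d$-regular multigraph $H$ on $k$ vertices (loops allowed, each contributing $1$ to the degree; adjacency matrix $M$ with $M_{ii}$ the number of loops), $\mathcal{L}_m(H)$ is the random lift. It has $km$ vertices split into fibers of size $m$ indexed by $V(H)$; each non-loop edge $\{i,j\}$ contributes an independent uniform perfect matching between fibers $i,j$, and each loop at $i$ contributes one within fiber $i$. It is conditioned on simplicity. Ramanujan conditions: $H$ is Ramanujan if $\max(|\lambda_2|,|\lambda_k|)\le2\sqrt{d-1}$. It is bipartite Ramanujan if it is bipartite and $\max(|\lambda_2|,|\lambda_{k-1}|)\le2\sqrt{d-1}$ (adjacency eigenvalues in decreasing order). Noise: $\Delta(G,G')=|E(G)\triangle E(G')|/(2n)$ for $d$-regular graphs on the same $n$ vertices. - $\mathcal{S}^{\mathrm{rand}}_\epsilon$ deletes $\lfloor\epsilon n\rfloor$ uniform random edges and adds $\lfloor\epsilon n\rfloor$ uniform random edges conditioned on $d$-regularity. - $\mathcal{S}^{\mathrm{rand,bi}}_\epsilon$ is the same, with the added edges across the bipartition. - Respectful versions (tilde), applied to lifts of $H$, condition on no added edge joining fibers of $i,j$ with $M_{ij}=0$. - $\mathcal{S}^{\mathrm{adv}}_\epsilon\mathcal{L}_m(H)$ is any law obtained by sampling $G\sim\mathcal{L}_m(H)$ and having an adversary output a $d$-regular $G'$ with $\Delta(G,G')\le\epsilon$.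 Respectful adversarial noise forbids the adversary from adding such cross-fiber edges. - Hardness under adversarial noise means some adversary makes detection hard. Strong detection means both error probabilities tend to $0$. Conjecture L with noise model $\mathcal S$ (non-bipartite part): for every $d$-regular Ramanujan multigraph $H$ on $k$ vertices and every $\epsilon>0$, no polynomial-time algorithm achieves strong detection between $\mathcal{S}_\epsilon\mathcal{L}_m(H)$ and $\mathcal{G}(km,d)$ as $m\to\infty$. Bipartite part: the same for bipartite Ramanujan $H$, versus $\mathcal{G}((\frac{km}2,\frac{km}2),d)$. Certification: an algorithm with output $c(G)$ certifies an upper bound on $f$ if $f(G)\le c(G)$ for all $d$-regular $G$. It certifies an upper bound $B$ with high probability if moreover $\Pr[c(G)\le B]\to1$ as $n\to\infty$. Ramanujan suprema: for $G$ a lift of $H$ and $G'$ on $V(G)$, $G'$ $H$-respects $G$ if $G'$ has no edge between the fibers of $i,j\in V(H)$ with $M_{ij}=0$. $G,G'$ are cobipartite if both are bipartite with the same bipartition. - $M(f)$ is the supremum of $c$ such that there exists a $d$-regular Ramanujan $H$ with the following property: for all sufficiently small $\epsilon>0$, with probability tending to $1$ as $m\to\infty$ over $G\sim\mathcal{L}_m(H)$, $\min\{f(G'):G'\ d\text{-regular},\ \Delta(G,G')\le\epsilon\}\ge c$. - $\widetilde M(f)$ is the same, but the minimum is only over $G'$ that $H$-respect $G$. - $M_{\mathrm{bi}}(f)$ is the same, but with $H$ bipartite Ramanujan and the minimum over $G'$ cobipartite with $G$. - $\widetilde M_{\mathrm{bi}}(f)$ has $H$ bipartite Ramanujan and the minimum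 over $G'$ that $H$-respect $G$. *)

(* Defs.v *)
From HB Require Import structures.
From mathcomp Require Import all_boot all_order all_algebra.
From mathcomp Require Import all_classical all_reals all_analysis.
Set Implicit Arguments.
Unset Strict Implicit.
Unset Printing Implicit Defensive.
Import Order.TTheory GRing.Theory Num.Theory.
Import numFieldNormedType.Exports.
Local Open Scope ring_scope.

(* A graph is its edge set.  Only the sets satisfying [simple_graph] are graphs. *)
Definition sgraph (n : nat) := {set {set 'I_n}}.

Definition simple_graph n (E : sgraph n) : bool := [forall e in E, #|e| == 2%N].

Definition regular_graph (d : nat) n (E : sgraph n) : bool :=
  simple_graph E && [forall v, #|[set e in E | v \in e]| == d].

Definition bipartite_by n (S : {set 'I_n}) (E : sgraph n) : bool :=
  [forall e in E, #|e :&: S| == 1%N].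

Definition cobipartite n (E E' : sgraph n) : bool :=
  [exists S : {set 'I_n}, bipartite_by S E && bipartite_by S E'].

Definition regular_graphs (d n : nat) : {set sgraph n} :=
  [set E | regular_graph d E].

(* In the bipartite setting the two sides are labelled: they are the two halves
   of 'I_n. *)
Definition left_half (n : nat) : {set 'I_n} := [set v : 'I_n | (v < n./2)%N].

Definition bipartite_regular_graphs (d n : nat) : {set sgraph n} :=
  [set E | [&& ~~ odd n, regular_graph d E & bipartite_by (left_half n) E]].

Definition Delta (R : realType) n (E E' : sgraph n) : R :=
  #|(E :\: E') :|: (E' :\: E)|%:R / (2 * n%:R).

(* M i j is the number of edges joining i and j, and M i i is the number of
   loops at i, each of which adds 1 to the degree. *)
Definition mregular (d k : nat) (M : 'M[nat]_k) : Prop :=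
  M^T = M /\ forall i, (\sum_j M i j)%N = d.

Definition mbipartition k (M : 'M[nat]_k) (side : 'I_k -> bool) : Prop :=
  forall i j, M i j != 0%N -> side i != side j.

(* s lists the eigenvalues with multiplicity in decreasing order, so that
   lambda_i is s`_i.-1. *)
Definition spectrum (R : realType) k (M : 'M[nat]_k) (s : seq R) : Prop :=
  sorted >=%R s /\
  char_poly (map_mx (fun a : nat => a%:R : R) M) = \prod_(x <- s) ('X - x%:P).

Definition ramanujan (R : realType) (d k : nat) (M : 'M[nat]_k) : Prop :=
  [/\ (1 < k)%N, mregular d M &
      exists2 s : seq R, spectrum M s &
        Num.max `|s`_1| `|s`_k.-1| <= 2 * Num.sqrt (d%:R - 1)].

Definition bipartite_ramanujan (R : realType) (d k : nat) (M : 'M[nat]_k)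
    (side : 'I_k -> bool) : Prop :=
  [/\ (1 < k)%N, mregular d M, mbipartition M side &
      exists2 s : seq R, spectrum M s &
        Num.max `|s`_1| `|s`_k.-2| <= 2 * Num.sqrt (d%:R - 1)].

Definition unif (R : realType) (T : finType) (A : {set T}) (x : T) : R :=
  (x \in A)%:R / #|A|%:R.

Definition Pr (R : realType) (T : finType) (mu : T -> R) (P : pred T) : R :=
  \sum_(x | P x) mu x.

(* Convergence along the sizes for which the random model is defined. *)
Definition tends_along (R : realType) (A : set nat) (u : nat -> R) (l : R) :
    Prop :=
  (u @ within A \oo --> l)%classic.

Definition fibering (k m : nat) := {ffun 'I_(k * m) -> 'I_k}.

(* The slot (i, j, t) stands for the t-th edge of the multigraph between i and
   j; all multiplicities of a d-regular multigraph are at most d. *)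
Definition slot (k d : nat) := ('I_k * 'I_k * 'I_d)%type.

Definition is_edge k d (M : 'M[nat]_k) (s : slot k d) : bool :=
  (s.1.1 <= s.1.2)%N && (s.2 < M s.1.1 s.1.2)%N.

(* A perfect matching between the fibers of i and j, or, when i = j, a perfect
   matching inside the fiber of i. *)
Definition fiber_matching n k (phi : 'I_n -> 'I_k) (i j : 'I_k)
    (P : sgraph n) : bool :=
  [forall e in P, [exists u, exists v,
     [&& u != v, e == [set u; v], phi u == i & phi v == j]]] &&
  [forall u, ((phi u == i) || (phi u == j)) ==>
     (#|[set e in P | u \in e]| == 1%N)].

(* A map from vertices to fibers together with one matching for each edge of
   the multigraph. *)
Definition lift_config (k d m : nat) :=
  (fibering k m * {ffun slot k d -> sgraph (k * m)})%type.

Definition lift_graph k d m (x : lift_config k d m) : sgraph (k * m) :=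
  \bigcup_(s : slot k d) x.2 s.

Definition labelling (k : nat) := forall m, pred (fibering k m).

Definition any_labelling k : labelling k := fun _ _ => true.

Definition sided_labelling k (side : 'I_k -> bool) : labelling k :=
  fun m phi => [forall u, side (phi u) == (u \in left_half (k * m))].

(* The uniform law on [lift_space] is the random lift: all fibers have size m,
   the split into fibers is uniform among those allowed by [lab], the matchings
   are independent and uniform, and everything is conditioned on the matchings
   being pairwise disjoint, that is on the lift being simple.  The split has to
   be random, since otherwise the labels would reveal the fibers. *)
Definition lift_space k d (M : 'M[nat]_k) (lab : labelling k) (m : nat) :
    {set lift_config k d m} :=
  [set x : lift_config k d m |
     [&& [forall i, #|[set u | x.1 u == i]| == m],
         lab m x.1,
         [forall s, if is_edge M s
                    then fiber_matching x.1 s.1.1 s.1.2 (x.2 s)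
                    else x.2 s == finset.set0] &
         [forall s, forall t, (s != t) ==> [disjoint x.2 s & x.2 t]]]].

Definition lift_sizes k d (M : 'M[nat]_k) (lab : labelling k) : set nat :=
  [set m | lift_space d M lab m != finset.set0]%classic.

Definition respects k m (M : 'M[nat]_k) (phi : fibering k m)
    (E : sgraph (k * m)) : bool :=
  [forall u, forall v, ([set u; v] \in E) ==> (M (phi u) (phi v) != 0%N)].

(* The conditional law of the noisy graph given the lift. *)
Definition noise_kernel (R : realType) (k d : nat) :=
  forall m, lift_config k d m -> sgraph (k * m) -> R.

(* The kernels which a noise model allows: exactly one for random noise, all
   admissible adversaries for adversarial noise. *)
Definition noise_model (R : realType) (d : nat) :=
  forall k, 'M[nat]_k -> R -> noise_kernel R k d -> Prop.

(* All edges are deleted if there are fewer than floor(eps * n). *)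
Definition deletions (R : realType) (eps : R) n (E : sgraph n) :
    {set sgraph n} :=
  [set D : sgraph n |
     (D \subset E) && (#|D| == minn (Num.truncn (eps * n%:R)) #|E|)].

Definition additions (d n : nat) (ok : pred (sgraph n)) (E D : sgraph n) :
    {set sgraph n} :=
  [set A : sgraph n | [&& #|A| == #|D|, [disjoint A & E :\: D],
                          regular_graph d ((E :\: D) :|: A) & ok A]].

Definition random_kernel (R : realType) k d (eps : R)
    (ok : forall m, fibering k m -> pred (sgraph (k * m))) : noise_kernel R k d :=
  fun m x E' =>
    let E := lift_graph x in
    \sum_D unif R (deletions eps E) D *
      \sum_A unif R (additions d (ok m x.1) E D) A *
        ((E :\: D) :|: A == E')%:R.

Definition S_rand (R : realType) (d : nat) : noise_model R d :=
  fun k M eps K => K = random_kernel eps (fun _ _ _ => true).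

Definition S_rand_resp (R : realType) (d : nat) : noise_model R d :=
  fun k M eps K => K = random_kernel eps (fun _ phi A => respects M phi A).

Definition S_rand_bi (R : realType) (d : nat) : noise_model R d :=
  fun k M eps K =>
    K = random_kernel eps (fun m _ A => bipartite_by (left_half (k * m)) A).

Definition S_rand_bi_resp (R : realType) (d : nat) : noise_model R d :=
  fun k M eps K =>
    K = random_kernel eps (fun m phi A =>
          bipartite_by (left_half (k * m)) A && respects M phi A).

Definition adversary (R : realType) k d (M : 'M[nat]_k) (eps : R)
    (ok : forall m, lift_config k d m -> pred (sgraph (k * m)))
    (K : noise_kernel R k d) : Prop :=
  forall m (x : lift_config k d m),
    x \in lift_space d M (@any_labelling k) m ->
    [/\ forall E', 0 <= K m x E',
        \sum_E' K m x E' = 1 &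
        forall E', K m x E' != 0 ->
          [&& regular_graph d E', Delta R (lift_graph x) E' <= eps & ok m x E']].

Definition S_adv (R : realType) (d : nat) : noise_model R d :=
  fun k M eps K => adversary M eps (fun _ _ _ => true) K.

Definition S_adv_resp (R : realType) (d : nat) : noise_model R d :=
  fun k M eps K =>
    adversary M eps (fun _ x E' => respects M x.1 (E' :\: lift_graph x)) K.

Definition noisy_lift (R : realType) k d (M : 'M[nat]_k) (lab : labelling k)
    (K : noise_kernel R k d) (m : nat) (E' : sgraph (k * m)) : R :=
  \sum_x unif R (lift_space d M lab m) x * K m x E'.

Inductive move := MoveL | MoveS | MoveR.

(* [None] is the blank symbol. *)
Definition symbol (G : finType) := option (bool + G).

(* The machine has tm_tapes.+1 tapes and halts when the transition function
   returns [None]. *)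
Record turing_machine := TuringMachine {
  tm_tapes : nat;
  tm_work : finType;
  tm_state : finType;
  tm_start : tm_state;
  tm_trans : tm_state -> {ffun 'I_tm_tapes.+1 -> symbol tm_work} ->
    option (tm_state * {ffun 'I_tm_tapes.+1 -> symbol tm_work * move}) }.

(* (l, r) is a two-way infinite tape: the head scans the first symbol of r, and
   l lists the symbols on its left, nearest first; the rest is blank. *)
Definition tape (G : finType) := (seq (symbol G) * seq (symbol G))%type.

Definition tape_read (G : finType) (tp : tape G) : symbol G := head None tp.2.

Definition tape_act (G : finType) (tp : tape G) (a : symbol G * move) :
    tape G :=
  match a.2 with
  | MoveL => (behead tp.1, head None tp.1 :: a.1 :: behead tp.2)
  | MoveS => (tp.1, a.1 :: behead tp.2)
  | MoveR => (a.1 :: tp.1, behead tp.2)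
  end.

Definition tm_config (T : turing_machine) :=
  (tm_state T * ('I_(tm_tapes T).+1 -> tape (tm_work T)))%type.

Definition tm_step (T : turing_machine) (c : tm_config T) :
    option (tm_config T) :=
  if tm_trans c.1 [ffun i => tape_read (c.2 i)] is Some (q, act)
  then Some (q, fun i => tape_act (c.2 i) (act i)) else None.

Fixpoint tm_run (T : turing_machine) (t : nat) (c : tm_config T) :
    tm_config T :=
  if t is t'.+1 then if tm_step c is Some c' then tm_run t' c' else c else c.

(* The input is on tape 0, with the head on its first bit. *)
Definition tm_init (T : turing_machine) (x : seq bool) : tm_config T :=
  (tm_start T,
   fun i => ([::], if i == ord0 then [seq Some (inl b) | b <- x] else [::])).

Fixpoint leading_bits (G : finType) (r : seq (symbol G)) : seq bool :=
  if r is Some (inl b) :: r' then b :: leading_bits r' else [::].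

(* The output is the maximal string of bits on tape 0 starting at the head. *)
Definition tm_output (T : turing_machine) (c : tm_config T) : seq bool :=
  leading_bits (c.2 ord0).2.

Definition tm_computes (T : turing_machine) (t : nat) (x y : seq bool) : Prop :=
  let c := tm_run t (tm_init T x) in tm_step c = None /\ tm_output c = y.

(* n in unary, then the adjacency matrix row by row. *)
Definition encode_graph n (E : sgraph n) : seq bool :=
  nseq n true ++
  false :: [seq [set i; j] \in E | i <- enum 'I_n, j <- enum 'I_n].

Definition graph_fun := forall n, sgraph n -> seq bool.

Definition poly_time (F : graph_fun) : Prop :=
  exists (T : turing_machine) (a b : nat),
    forall n (E : sgraph n), simple_graph E ->
      tm_computes T (a * n ^ b + a) (encode_graph E) (F n E).

(* Binary, least significant bit first. *)
Fixpoint bits_to_nat (s : seq bool) : nat :=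
  if s is b :: s' then (b + (bits_to_nat s').*2)%N else 0%N.

Fixpoint even_bits (s : seq bool) : seq bool :=
  if s is b :: s' then b :: (if s' is _ :: s'' then even_bits s'' else [::])
  else [::].

(* A rational number: a sign bit, followed by the interleaved binary expansions
   of the numerator and of the denominator minus one. *)
Definition decode_num (R : realType) (s : seq bool) : R :=
  let t := behead s in
  (-1) ^+ head false s * (bits_to_nat (even_bits t))%:R
    / (bits_to_nat (even_bits (behead t))).+1%:R.

(* The test answers "lift" when its first output bit is [true]. *)
Definition strong_detection (R : realType) (size : nat -> nat) (A : set nat)
    (planted null : forall m, sgraph (size m) -> R) : Prop :=
  exists F : graph_fun,
    [/\ poly_time F,
        tends_along A
          (fun m => Pr (null m) (fun E => head false (F (size m) E))) 0 &
        tends_along A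
          (fun m => Pr (planted m) (fun E => ~~ head false (F (size m) E))) 0].

Definition lift_conjecture (R : realType) (d : nat) (S : noise_model R d) :
    Prop :=
  forall k (M : 'M[nat]_k), ramanujan R d M ->
  forall eps : R, 0 < eps ->
  exists2 K : noise_kernel R k d, S k M eps K &
    ~ strong_detection (lift_sizes d M (@any_labelling k))
        (noisy_lift M (@any_labelling k) K)
        (fun m => unif R (regular_graphs d (k * m))).

Definition lift_conjecture_bi (R : realType) (d : nat) (S : noise_model R d) :
    Prop :=
  forall k (M : 'M[nat]_k) (side : 'I_k -> bool),
  bipartite_ramanujan R d M side ->
  forall eps : R, 0 < eps ->
  exists2 K : noise_kernel R k d, S k M eps K &
    ~ strong_detection (lift_sizes d M (sided_labelling side))
        (noisy_lift M (sided_labelling side) K)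
        (fun m => unif R (bipartite_regular_graphs d (k * m))).

(* f is only ever evaluated at d-regular graphs. *)
Definition certifies_whp (R : realType) (d : nat) (f : forall n, sgraph n -> R)
    (space : forall n, {set sgraph n}) (B : R) (F : graph_fun) : Prop :=
  (forall n (E : sgraph n), regular_graph d E -> f n E <= decode_num R (F n E)) /\
  tends_along [set n | space n != finset.set0]%classic
    (fun n => Pr (unif R (space n)) (fun E => decode_num R (F n E) <= B)) 1.

Definition certifiable (R : realType) (d : nat) (f : forall n, sgraph n -> R)
    (space : forall n, {set sgraph n}) (B : R) : Prop :=
  exists2 F : graph_fun, poly_time F & certifies_whp d f space B F.

Definition robustly_ge (R : realType) k d (f : forall n, sgraph n -> R)
    (M : 'M[nat]_k) (lab : labelling k)
    (ok : forall m, lift_config k d m -> pred (sgraph (k * m))) (c : R) : Prop :=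
  \forall eps \near ((0 : R)^'+)%classic,
    tends_along (lift_sizes d M lab)
      (fun m => Pr (unif R (lift_space d M lab m))
        (fun x => [forall E' : sgraph (k * m),
           [&& regular_graph d E', Delta R (lift_graph x) E' <= eps & ok m x E'] ==>
           (c <= f (k * m)%N E')])) 1.

Definition M_sup (R : realType) (d : nat) (f : forall n, sgraph n -> R) :
    \bar R :=
  ereal_sup [set c%:E | c in [set c : R | exists k (M : 'M[nat]_k),
    ramanujan R d M /\
    robustly_ge f M (@any_labelling k) (fun m (x : lift_config k d m) _ => true)
      c]]%classic.

Definition M_resp_sup (R : realType) (d : nat) (f : forall n, sgraph n -> R) :
    \bar R :=
  ereal_sup [set c%:E | c in [set c : R | exists k (M : 'M[nat]_k),
    ramanujan R d M /\
    robustly_ge f M (@any_labelling k)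
      (fun m (x : lift_config k d m) E' => respects M x.1 E') c]]%classic.

Definition M_bi_sup (R : realType) (d : nat) (f : forall n, sgraph n -> R) :
    \bar R :=
  ereal_sup [set c%:E | c in [set c : R |
    exists k (M : 'M[nat]_k) (side : 'I_k -> bool),
    bipartite_ramanujan R d M side /\
    robustly_ge f M (sided_labelling side)
      (fun m (x : lift_config k d m) E' => cobipartite (lift_graph x) E') c]]%classic.

Definition M_bi_resp_sup (R : realType) (d : nat)
    (f : forall n, sgraph n -> R) : \bar R :=
  ereal_sup [set c%:E | c in [set c : R |
    exists k (M : 'M[nat]_k) (side : 'I_k -> bool),
    bipartite_ramanujan R d M side /\
    robustly_ge f M (sided_labelling side)
      (fun m (x : lift_config k d m) E' => respects M x.1 E') c]]%classic.

(* Main.v *)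
(** A certifier of an upper bound B < c on f yields a distinguisher: pick a
    rational q between B and c and answer "lift" when the certified bound
    exceeds q.  On a null graph the certified bound is at most B with high
    probability; on a noisy lift f is at least c with high probability, and the
    certified bound is at least f.  As the certified bound is printed from its
    least significant bit on, comparing it with q is the job of a finite
    automaton that reads the output of the certifier once.  Against an adversary
    that need not preserve the bipartition, the distinguisher also answers
    "lift" when the graph is not bipartite along the two halves of its vertex
    set; this is tested by a machine with two counter tapes that sweeps once
    over the adjacency matrix. *)

From HB Require Import structures.
Require Import Defs.
From mathcomp Require Import all_boot all_order all_algebra.
From mathcomp Require Import all_classical all_reals all_analysis.
From mathcomp Require Import zify ring lra.
Set Implicit Arguments.
Unset Strict Implicit.
Unset Printing Implicit Defensive.
Import Order.TTheory GRing.Theory Num.Theory.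
Import numFieldNormedType.Exports.

(** * Running Turing machines *)

Section Reach.
Variables (X : Type) (step : X -> option X).

(** Unlike [tm_run], this fails when the machine halts early, so runs compose and can be transported
    along simulations without side conditions; [reach] relaxes the exact count to a bound. *)
Fixpoint steps (t : nat) (c : X) : option X :=
  if t is t'.+1 then obind (steps t') (step c) else Some c.

Definition reach (t : nat) (c c' : X) : Prop :=
  exists2 t', t' <= t & steps t' c = Some c'.

Lemma steps_trans s t c c1 c2 :
  steps s c = Some c1 -> steps t c1 = Some c2 -> steps (s + t) c = Some c2.
Proof.
elim: s c => [|s IHs] c /=; first by case=> ->.
by case: (step c) => //= c'; apply: IHs.
Qed.

Lemma reach_refl t c : reach t c c.
Proof. by exists 0. Qed.

Lemma reach_step t c c1 c2 :
  step c = Some c1 -> reach t c1 c2 -> reach t.+1 c c2.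
Proof. by move=> e [t' le_t'] H; exists t'.+1; rewrite //= e. Qed.

Lemma reach_trans s t c c1 c2 :
  reach s c c1 -> reach t c1 c2 -> reach (s + t) c c2.
Proof.
move=> [s' le_s' Hs] [t' le_t' Ht]; exists (s' + t'); first exact: leq_add.
exact: steps_trans Hs Ht.
Qed.

Lemma reach_le s t c c' : s <= t -> reach s c c' -> reach t c c'.
Proof. by move=> le_st [s' le_s' Hs]; exists s' => //; apply: leq_trans le_st. Qed.

End Reach.

Lemma simulate (X Y : Type) (step : X -> option X) (step' : Y -> option Y)
    (sim : X -> Y -> Prop) :
  (forall c e c1, sim c e -> step c = Some c1 ->
     exists2 e1, step' e = Some e1 & sim c1 e1) ->
  forall t c e c1, sim c e -> reach step t c c1 ->
  exists2 e1, reach step' t e e1 & sim c1 e1.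
Proof.
move=> Hstep t c e c1 Hce [t' le_t' Ht'].
suff [e1 He1 ?] : exists2 e1, steps step' t' e = Some e1 & sim c1 e1.
  by exists e1 => //; exists t'.
elim: t' c e Hce {le_t'} Ht' => [|t' IHt] c e Hce /=; first by case=> <-; exists e.
case E: (step c) => [c'|] //= Ht'.
have [e' -> He'] := Hstep _ _ _ Hce E.
exact: IHt He' Ht'.
Qed.

Section Runs.
Variable T : turing_machine.
Implicit Type c : tm_config T.

Lemma tm_run_halted t c : tm_step c = None -> tm_run t c = c.
Proof. by case: t => //= t ->. Qed.

Lemma tm_run_reach t c c' :
  reach (@tm_step T) t c c' -> tm_step c' = None -> tm_run t c = c'.
Proof.
move=> [t' le_t' Ht'] Hc'; rewrite -(subnKC le_t').
move: (t - t') => u; elim: t' c Ht' {le_t'} => [|t' IHt] c /=; first by case=> ->; apply: tm_run_halted.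
by case: (tm_step c) => //= c1; apply: IHt.
Qed.

Lemma reach_tm_run t c : reach (@tm_step T) t c (tm_run t c).
Proof.
elim: t c => [|t IHt] c; first exact: reach_refl.
rewrite /=; case E: (tm_step c) => [c1|]; last exact: reach_refl.
exact: reach_step E (IHt c1).
Qed.

End Runs.

(** [F] is read off the machine when its time budget expires, hence is defined on every edge set,
    including those that are not graphs. The output at halting is unique, so it is the one known to
    satisfy [P]. *)
Lemma poly_time_witness (P : forall n, sgraph n -> seq bool -> Prop)
    (T : turing_machine) (a b : nat) :
  (forall n (E : sgraph n), simple_graph E ->
     exists2 y, P n E y & tm_computes T (a * n ^ b + a) (encode_graph E) y) ->
  exists2 F : graph_fun, poly_time F &
    forall n (E : sgraph n), simple_graph E -> P n E (F n E).
Proof.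
move=> H.
exists (fun n E => tm_output (tm_run (a * n ^ b + a) (tm_init T (encode_graph E)))).
  exists T, a, b => n E sE; have [y _ []] := H n E sE.
  by rewrite /tm_computes.
by move=> n E sE; have [y Py [_ ->]] := H n E sE.
Qed.

(** The summand 1 covers [n = 0] and [b = 0 < c], where the left side is 1 and the power on the
    right is 0. *)
Lemma expn_le_add n b c : b <= c -> n ^ b <= n ^ c + 1.
Proof.
move=> le_bc; case: n => [|n]; first by rewrite addn1 (@leq_trans 1) //; case: b {le_bc} => // b; rewrite exp0n.
by rewrite (leq_trans (leq_pexp2l _ le_bc)) // leq_addr.
Qed.

Lemma size_encode_graph n (E : sgraph n) :
  size (encode_graph E) = n + (n ^ 2).+1.
Proof. by rewrite size_cat size_nseq /= size_allpairs size_enum_ord mulnn. Qed.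

(* The verdict is written in front of whatever follows the output of T on the
   tape, so only the first bit of the new output is meaningful. *)
Section Automaton.
Variables (T : turing_machine) (Q : finType) (q0 : Q).
Variables (next : Q -> bool -> Q) (acc : Q -> bool).

Definition dfa_trans (s : tm_state T + option Q)
    (g : {ffun 'I_(tm_tapes T).+1 -> symbol (tm_work T)}) :
    option ((tm_state T + option Q) *
            {ffun 'I_(tm_tapes T).+1 -> symbol (tm_work T) * move}) :=
  match s with
  | inl q => if tm_trans q g is Some (q', act) then Some (inl q', act)
             else Some (inr (Some q0), [ffun i => (g i, MoveS)])
  | inr (Some q) =>
      if g ord0 is Some (inl b)
      then Some (inr (Some (next q b)),
                 [ffun i => (g i, if i == ord0 then MoveR else MoveS)])
      else Some (inr None, [ffun i =>
                   (if i == ord0 then Some (inl (acc q)) else g i, MoveS)])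
  | inr None => None
  end.

Definition dfa_tm := TuringMachine (inl (tm_start T)) dfa_trans.

Lemma dfa_scan q (tp : 'I_(tm_tapes T).+1 -> tape (tm_work T)) :
  exists c' : tm_config dfa_tm,
    [/\ reach (@tm_step dfa_tm) (size (leading_bits (tp ord0).2)).+1
          (inr (Some q), tp) c',
        tm_step c' = None &
        head false (tm_output c') = acc (foldl next q (leading_bits (tp ord0).2))].
Proof.
move Er: (tp ord0).2 => r; elim: r q tp Er => [|x r IHr] q tp Er.
  eexists (inr None, _); split=> //.
    apply: reach_step (reach_refl _ _ _).
    by rewrite /tm_step /= ffunE /tape_read Er /=.
  by rewrite /tm_output /= ffunE /= /tape_act /= .
case: x Er => [[b|y]|] Er.
- set tp' := fun i : 'I__ =>
    tape_act (tp i) (tape_read (tp i), if i == ord0 then MoveR else MoveS).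
  have [|c' [Hr Hh Ho]] := IHr (next q b) tp'.
    by rewrite /tp' /= Er.
  exists c'; split=> //; apply: reach_step Hr.
  rewrite /tm_step /= ffunE /tape_read Er /=; congr (Some (_, _)).
  by apply: funext => i; rewrite !ffunE.
- eexists (inr None, _); split=> //.
    apply: reach_step (reach_refl _ _ _).
    by rewrite /tm_step /= ffunE /tape_read Er /=.
  by rewrite /tm_output /= ffunE /=.
- eexists (inr None, _); split=> //.
    apply: reach_step (reach_refl _ _ _).
    by rewrite /tm_step /= ffunE /tape_read Er /=.
  by rewrite /tm_output /= ffunE /=.
Qed.

Lemma dfa_tm_halts t (x : seq bool) y : tm_computes T t x y ->
  exists2 y', tm_computes dfa_tm (t + (size y).+2) x y' &
    head false y' = acc (foldl next q0 y).
Proof.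
move=> [Hh Hy].
pose sim (c : tm_config T) (e : tm_config dfa_tm) := e = (inl c.1, c.2).
have [|e Hr He] := @simulate _ _ (@tm_step T) (@tm_step dfa_tm) sim _ t (tm_init T x)
    (tm_init dfa_tm x) _ erefl (reach_tm_run t (tm_init T x)).
  move=> c _ c1 ->; rewrite /tm_step /=.
  case: (tm_trans _ _) => // -[q' act] [<-].
  by eexists; first reflexivity.
set c := tm_run t _ in Hh Hy He.
(* The handover step rewrites every scanned symbol. On an exhausted tape this stores an explicit
   blank, which does not change the leading bits. *)
set tp := fun i : 'I__ => tape_act (c.2 i) (tape_read (c.2 i), MoveS).
have Ey : leading_bits (tp ord0).2 = y.
  by rewrite -Hy /tm_output /tp /= /tape_read; case: (c.2 ord0).2.
have [c' [Hr' Hh' Ho']] := dfa_scan q0 tp.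
exists (tm_output c'); last by rewrite Ho' Ey.
suff: reach (@tm_step dfa_tm) (t + (size y).+2) (tm_init dfa_tm x) c'.
  by move=> H; rewrite /tm_computes (tm_run_reach H Hh').
apply: reach_trans Hr _; rewrite He; rewrite Ey in Hr'.
apply: reach_step Hr'.
move: Hh; rewrite /tm_step /=; case: (tm_trans _ _) => [[]|] // _.
congr (Some (_, _)); apply: funext => i; by rewrite !ffunE.
Qed.

End Automaton.

Lemma size_leading_bits (G : finType) (r : seq (symbol G)) :
  size (leading_bits r) <= size r.
Proof. by elim: r => //= -[[b|]|] r //= IHr. Qed.

Lemma size_tm_output (T : turing_machine) t x y :
  tm_computes T t x y -> size y <= size x + 2 * t.
Proof.
move=> [_ <-]; apply: leq_trans (size_leading_bits _) _.
have -> : size x = size ((tm_init T x).2 ord0).2 by rewrite /= size_map.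
elim: t (tm_init T x) => [|t IHt] c /=; first by rewrite addn0.
case E: (tm_step c) => [c'|]; last by rewrite leq_addr.
apply: leq_trans (IHt c') _; rewrite mulnS addnA leq_add2r.
move: E; rewrite /tm_step; case: (tm_trans _ _) => // -[q act] [<-] /=.
rewrite /tape_act; case: (act ord0).2 => /=; rewrite ?size_behead; lia.
Qed.

Lemma poly_time_dfa (F : graph_fun) (Q : finType) (q0 : Q)
    (next : Q -> bool -> Q) (acc : Q -> bool) : poly_time F ->
  exists2 F' : graph_fun, poly_time F' &
    forall n (E : sgraph n), simple_graph E ->
      head false (F' n E) = acc (foldl next q0 (F n E)).
Proof.
move=> [T [a [b H]]].
apply: (poly_time_witness
  (P := fun n E y => head false y = acc (foldl next q0 (F n E)))
  (T := dfa_tm T q0 next acc)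
  (a := 6 * a + 10) (b := b + 2)) => n E sE.
have HF := H n E sE.
have [y Hy Ey] := dfa_tm_halts q0 next acc HF.
exists y => //.
(* With t = a n^b + a the output has at most n + n^2 + 1 + 2t bits, so the total is at most 3t + n +
   n^2 + 3; each power is at most n^(b+2) + 1. *)
suff le_t : a * n ^ b + a + (size (F n E)).+2 <=
     (6 * a + 10) * n ^ (b + 2) + (6 * a + 10).
  case: Hy => Hh Ho.
  have Hr := reach_le le_t (reach_tm_run _ (tm_init (dfa_tm T q0 next acc) (encode_graph E))).
  by rewrite /tm_computes (tm_run_reach Hr Hh).
have := size_tm_output HF; rewrite size_encode_graph.
have := @expn_le_add n 1 (b + 2) ltac:(lia).
have := @expn_le_add n 2 (b + 2) ltac:(lia).
have := @expn_le_add n b (b + 2) ltac:(lia).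
rewrite expn1; move: (n ^ b) (n ^ (b + 2)) (n ^ 2) => u v w; nia.
Qed.

(** * Testing bipartiteness along the halves *)

(* Equality of tapes as two-way infinite words, i.e. up to trailing blanks. *)
Definition tape_eq (G : finType) (x y : tape G) : Prop :=
  nth None x.1 =1 nth None y.1 /\ nth None x.2 =1 nth None y.2.

Lemma tape_eq_read (G : finType) (x y : tape G) :
  tape_eq x y -> tape_read x = tape_read y.
Proof. by case=> _ /(_ 0); rewrite !nth0. Qed.

Lemma tape_eq_act (G : finType) (x y : tape G) a :
  tape_eq x y -> tape_eq (tape_act x a) (tape_act y a).
Proof.
move=> [El Er]; case: a => s [] /=; split=> /=.
- by move=> i; rewrite !nth_behead.
- by case=> [|[|i]] //=; rewrite ?nth_behead // -!nth0.
- by [].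
- by case=> [|i] //=; rewrite !nth_behead.
- by case=> [|i] /=.
- by move=> i; rewrite !nth_behead.
Qed.

Lemma leading_bits_eq (G : finType) (r s : seq (symbol G)) :
  nth None r =1 nth None s -> leading_bits r = leading_bits s.
Proof.
elim: r s => [|x r IHr] [|y s] // E; have /= := E 0.
- by move=> <-.
- by move=> ->.
move=> ->; have {}E : nth None r =1 nth None s by move=> i; apply: (E i.+1).
by case: y => [[b|]|] //=; congr cons; apply: IHr.
Qed.

Inductive check_state := CInit | CCount of bool | CScan of bool | CRewind | CHalt.

Definition check_state_code (q : check_state) : option (bool * bool) + bool :=
  match q with
  | CInit => inl None | CCount b => inl (Some (true, b))
  | CScan b => inl (Some (false, b)) | CRewind => inr true | CHalt => inr false
  end.

Definition check_state_decode (q : option (bool * bool) + bool) : check_state :=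
  match q with
  | inl None => CInit | inl (Some (true, b)) => CCount b
  | inl (Some (false, b)) => CScan b | inr true => CRewind | inr false => CHalt
  end.

Lemma check_state_codeK : cancel check_state_code check_state_decode.
Proof. by do 2?case. Qed.

HB.instance Definition _ := Countable.copy check_state (can_type check_state_codeK).
HB.instance Definition _ := Finite.copy check_state (can_type check_state_codeK).

Section Check.
Variable G : finType.

Let mark : symbol G := Some (inl true).
Let bits (w : seq bool) : seq (symbol G) := [seq Some (inl b) | b <- w].

(* Three tapes: the input, a column counter and a row counter.  While the unary
   part of the input is read, one mark for every two bits is written on both
   counters; an odd number of vertices is rejected.  During the scan of the
   matrix, the head of the column counter goes back and forth over the marks,
   so that its direction ([CScan true] is leftwards) tells the half of the
   column; the head of the row counter moves left once per row and scans a mark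
   exactly during the rows of the first half.  Rejecting means halting with the
   head of the first tape on a bit [true]; the next state [None] hands over to
   the machine that runs after the check. *)
Definition check_trans (q : check_state) (s0 sa sb : symbol G) :
    option (option check_state *
            ((symbol G * move) * (symbol G * move) * (symbol G * move))) :=
  match q with
  | CInit => Some (Some (CCount false), ((s0, MoveS), (None, MoveR), (sb, MoveS)))
  | CCount par =>
      match s0 with
      | Some (inl true) =>
          Some (Some (CCount (~~ par)),
                ((s0, MoveR), if par then (mark, MoveR) else (sa, MoveS),
                 if par then (mark, MoveR) else (sb, MoveS)))
      | Some (inl false) =>
          if par
          then Some (Some CHalt, ((mark, MoveS), (sa, MoveS), (sb, MoveS)))
          else Some (Some (CScan true), ((s0, MoveR), (sa, MoveL), (sb, MoveL)))
      | _ => None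
      end
  | CScan lft =>
      if s0 is Some (inl b) then
        if sa is Some _ then
          if b && (lft == (sb != None)) then None
          else Some (Some (CScan lft),
                     ((s0, MoveR), (sa, if lft then MoveL else MoveR), (sb, MoveS)))
        else Some (Some (CScan (~~ lft)),
                   ((s0, MoveS), (sa, if lft then MoveR else MoveL),
                    (sb, if lft then MoveS else MoveL)))
      else Some (Some CRewind, ((s0, MoveL), (sa, MoveS), (sb, MoveS)))
  | CRewind =>
      if s0 is Some _
      then Some (Some CRewind, ((s0, MoveL), (sa, MoveS), (sb, MoveS)))
      else Some (None, ((s0, MoveR), (sa, MoveS), (sb, MoveS)))
  | CHalt => None
  end.

Definition check_config :=
  (option check_state * (tape G * tape G * tape G))%type.

Definition check_step (c : check_config) : option check_config :=
  let: (oq, (x0, xa, xb)) := c in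
  if oq is Some q then
    if check_trans q (tape_read x0) (tape_read xa) (tape_read xb)
      is Some (q', (w0, wa, wb))
    then Some (q', (tape_act x0 w0, tape_act xa wa, tape_act xb wb)) else None
  else None.

(** [check_step] also has no successor in the state [None], where the combined machine goes on with
    [T]; the last condition excludes that case. *)
Definition check_rejects t (c : check_config) : Prop :=
  exists c', [/\ reach check_step t c c', check_step c' = None &
                 tape_read c'.2.1.1 = mark /\ c'.1 != None].

Lemma check_rejects_reach s t c c1 :
  reach check_step s c c1 -> check_rejects t c1 -> check_rejects (s + t) c.
Proof.
by move=> H [c' [Hc' Hh Hr]]; exists c'; split=> //; apply: reach_trans H Hc'.
Qed.

Lemma check_rejects_le s t c : s <= t -> check_rejects s c -> check_rejects t c.
Proof.
by move=> le_st [c' [Hc' Hh Hr]]; exists c'; split=> //; apply: reach_le Hc'.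
Qed.

(** The column counter has an explicit blank at its left end, on which its head will turn. The
    explicit blanks to the right of the row head vary during the count, hence [e] and [e']. *)
Lemma count_pairs h p e l0 r0 :
  exists e', reach check_step (2 * h)
    (Some (CCount false),
     ((l0, nseq (2 * h) mark ++ r0), (nseq p mark ++ [:: None], [::]),
      (nseq p mark, nseq e None)))
    (Some (CCount false),
     ((nseq (2 * h) mark ++ l0, r0), (nseq (h + p) mark ++ [:: None], [::]),
      (nseq (h + p) mark, nseq e' None))).
Proof.
elim: h p e l0 => [|h IHh] p e l0; first by exists e; exact: reach_refl.
have E r : nseq (2 * h.+1) mark ++ r = mark :: mark :: nseq (2 * h) mark ++ r.
  by rewrite mulnS.
have E' r : nseq (2 * h) mark ++ mark :: mark :: r = mark :: mark :: nseq (2 * h) mark ++ r.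
  by elim: (2 * h) => //= u ->.
rewrite !E -(E' l0) addSnnS mulnS.
have [e' H] := IHh p.+1 e.-1 (mark :: mark :: l0); exists e'.
apply: reach_trans H; apply: reach_step; first by [].
by apply: reach_step; last exact: reach_refl; case: (e).
Qed.

(** * The scan of the adjacency matrix *)

Section Scan.
Variable h : nat.

(** The head is on the [p]-th mark, counted from the blank at the left end, and on that blank itself
    when [p = 0]. *)
Definition col_left p : tape G :=
  (behead (nseq p mark ++ [:: None]),
   head None (nseq p mark ++ [:: None]) :: nseq (h - p) mark ++ [:: None]).

(** Here the [p] marks lie strictly to the left of the head, so for [p = h] the head scans the blank
    beyond the marks. *)
Definition col_right p : tape G :=
  (nseq p mark ++ [:: None], nseq (h - p) mark ++ [:: None]).

(** The leftward pass reads columns of the first half, so a bit [true] is an edge inside a half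
    exactly when the row counter shows a mark. Staying put may store an explicit blank on that
    counter, so only its scanned symbol and its left part are tracked. *)
Lemma scan_left w l0 r0 xb : size w <= h ->
  let c := (Some (CScan true), ((l0, bits w ++ r0), col_left (size w), xb)) in
  if (tape_read xb != None) && has id w then check_rejects (size w) c
  else exists2 xb', tape_read xb' = tape_read xb /\ xb'.1 = xb.1 &
    reach check_step (size w) c
      (Some (CScan true), ((rev (bits w) ++ l0, r0), col_left 0, xb')).
Proof.
elim: w l0 xb => [|b w IHw] l0 xb le_h c.
  by rewrite andbF; exists xb => //; exact: reach_refl.
have Eb : check_step c = if b && (tape_read xb != None) then None else
    Some (Some (CScan true),
      ((Some (inl b) :: l0, bits w ++ r0), col_left (size w),
       tape_act xb (tape_read xb, MoveS))).
  have E : h - size w = (h - (size w).+1).+1 by move: le_h => /=; lia.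
  rewrite /c /= /col_left E /=.
  by case: (tape_read xb) => //=; case: (b).
have := IHw (Some (inl b) :: l0) (tape_act xb (tape_read xb, MoveS)) (ltnW le_h).
rewrite /= {1}/tape_read /=.
case: (boolP (tape_read xb != None)) Eb => Hxb; rewrite ?andbT ?andbF /=.
  case: b le_h @c => le_h c Eb H /=.
    by exists c; split=> //; exact: reach_refl.
  move: H; case: (has id w).
    move=> H; apply: (check_rejects_reach (s := 1)) H.
    exact: (reach_step (step := check_step) (c := c) Eb (reach_refl _ _ _)).
  case=> xb' [E1 E2] H; exists xb'; first by rewrite E1 E2.
  by rewrite rev_cons cat_rcons; exact: (reach_step (step := check_step) (c := c) Eb H).
move=> Eb [xb' [E1 E2] H]; exists xb'; first by rewrite E1 E2.
by rewrite rev_cons cat_rcons; exact: (reach_step (step := check_step) (c := c) Eb H).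
Qed.

Lemma scan_right w l0 r0 xb : size w <= h ->
  let c := (Some (CScan false), ((l0, bits w ++ r0), col_right (h - size w), xb)) in
  if (tape_read xb == None) && has id w then check_rejects (size w) c
  else exists2 xb', tape_read xb' = tape_read xb /\ xb'.1 = xb.1 &
    reach check_step (size w) c
      (Some (CScan false), ((rev (bits w) ++ l0, r0), col_right h, xb')).
Proof.
elim: w l0 xb => [|b w IHw] l0 xb le_h c.
  by rewrite andbF; exists xb => //; rewrite /c /= subn0; exact: reach_refl.
have Eb : check_step c = if b && (tape_read xb == None) then None else
    Some (Some (CScan false),
      ((Some (inl b) :: l0, bits w ++ r0), col_right (h - size w),
       tape_act xb (tape_read xb, MoveS))).
  have E1 : h - (h - (size w).+1) = (size w).+1 by move: le_h => /=; lia.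
  have E2 : h - (h - size w) = size w by move: le_h => /=; lia.
  have E3 : h - size w = (h - (size w).+1).+1 by move: le_h => /=; lia.
  rewrite /c /= /col_right E1 E2 E3 /=.
  by case: (tape_read xb) => //=; case: (b).
have := IHw (Some (inl b) :: l0) (tape_act xb (tape_read xb, MoveS)) (ltnW le_h).
rewrite /= {1}/tape_read /=.
case: (boolP (tape_read xb == None)) Eb => Hxb; rewrite ?andbT ?andbF /=.
  case: b le_h @c => le_h c Eb H /=.
    by exists c; split=> //; exact: reach_refl.
  move: H; case: (has id w).
    move=> H; apply: (check_rejects_reach (s := 1)) H.
    exact: (reach_step (step := check_step) (c := c) Eb (reach_refl _ _ _)).
  case=> xb' [E1 E2] H; exists xb'; first by rewrite E1 E2.
  by rewrite rev_cons cat_rcons; exact: (reach_step (step := check_step) (c := c) Eb H).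
move=> Eb [xb' [E1 E2] H]; exists xb'; first by rewrite E1 E2.
by rewrite rev_cons cat_rcons; exact: (reach_step (step := check_step) (c := c) Eb H).
Qed.

(** The head starts row 0 on the last of [h] marks. Truncated subtraction keeps the left part empty
    once the marks are used up, that is, through all rows of the second half. *)
Definition row_tape i (xb : tape G) : Prop :=
  xb.1 = nseq (h - i.+1) mark /\ tape_read xb = if i < h then mark else None.

(** Vertex [i] has a neighbour in its own half. *)
Definition row_bad i (w : seq bool) : bool :=
  has id (if i < h then take h w else drop h w).

Lemma scan_row i w l0 r0 xb : 0 < h -> size w = h + h -> row_tape i xb ->
  let c := (Some (CScan true), ((l0, bits w ++ r0), col_left h, xb)) in
  if row_bad i w then check_rejects (h + h.+1) c
  else exists2 xb', row_tape i xb' &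
    reach check_step (h + h.+1) c
      (Some (CScan false), ((rev (bits w) ++ l0, r0), col_right h, xb')).
Proof.
move=> h_gt0 sz_w [Eb1 Eb2] c; rewrite /row_bad.
have sz1 : size (take h w) = h by rewrite size_takel // sz_w leq_addr.
have sz2 : size (drop h w) = h by rewrite size_drop sz_w addnK.
(* The column head turns only while a bit is scanned on the input tape. For the same reason the turn
   at the end of the row is left to the next row. *)
have [b [w2 Ew2]] : exists b w2, drop h w = b :: w2.
  by case: (drop h w) sz2 h_gt0 => [<-|b w2] // _ _; exists b, w2.
have := @scan_left (take h w) l0 (bits (drop h w) ++ r0) xb.
rewrite sz1 leqnn => /(_ isT) /=.
have -> : bits (take h w) ++ bits (drop h w) ++ r0 = bits w ++ r0.
  by rewrite catA -map_cat cat_take_drop.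
rewrite Eb2; case: ltnP => [lt_ih|le_hi] /=.
  case: ifP => _ H; first by apply: check_rejects_le H; rewrite leq_addr.
  have [xb1 [E1 E2] H1] := H.
  have := @scan_right (drop h w) (rev (bits (take h w)) ++ l0) r0
            (tape_act xb1 (tape_read xb1, MoveS)).
  rewrite sz2 leqnn subnn => /(_ isT); rewrite (_ : tape_read (tape_act _ _) = tape_read xb1) // E1 /=.
  case=> xb2 [F1 F2] H2; exists xb2.
    by split; [rewrite F2 /= E2 | rewrite F1 lt_ih].
  apply: reach_trans H1 _; apply: reach_step; last first.
    by move: H2; rewrite catA -rev_cat -map_cat cat_take_drop; exact.
  by rewrite /= Ew2 /= /col_right /col_left !subn0 E1.
case=> xb1 [E1 E2] H1.
have := @scan_right (drop h w) (rev (bits (take h w)) ++ l0) r0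
          (tape_act xb1 (tape_read xb1, MoveS)).
have H1' : reach check_step h.+1 c (Some (CScan false),
    ((rev (bits (take h w)) ++ l0, bits (drop h w) ++ r0), col_right 0,
     tape_act xb1 (tape_read xb1, MoveS))).
  rewrite -addn1; apply: reach_trans H1 _; apply: reach_step (reach_refl _ _ _).
  by rewrite /= Ew2 /= /col_right /col_left !subn0.
rewrite E1 in H1'; have ri : (i < h) = false by rewrite ltnNge le_hi.
rewrite sz2 leqnn subnn => /(_ isT); rewrite (_ : tape_read (tape_act _ _) = tape_read xb1) // E1 /=.
case: ifP => _; first by move=> H2; rewrite addnC; apply: check_rejects_reach H1' H2.
case=> xb2 [F1 F2] H2; exists xb2.
  by split; [rewrite F2 /= E2 | rewrite F1 ri].
rewrite addnC; apply: reach_trans H1' _.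
by move: H2; rewrite catA -rev_cat -map_cat cat_take_drop.
Qed.

Fixpoint rows_bad i (rows : seq (seq bool)) : bool :=
  if rows is w :: rows' then row_bad i w || rows_bad i.+1 rows' else false.

Lemma scan_rows i rows l0 xb : (rows != [::] -> 0 < h) ->
  all (fun w => size w == h + h) rows -> row_tape i xb ->
  let c := (Some (CScan true), ((l0, bits (flatten rows)), col_left h, xb)) in
  let t := size rows * (h + h).+2 in
  let l := rev (bits (flatten rows)) ++ l0 in
  if rows_bad i rows then check_rejects t.+1 c
  else exists xa xb', reach check_step t.+1 c
      (Some CRewind, ((behead l, head None l :: [:: None]), xa, xb')).
Proof.
elim: rows i l0 xb => [|w rows IH] i l0 xb h_gt0 sz_rows row_xb /=.
  by do 2!eexists; apply: reach_step (reach_refl _ _ _).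
have {}h_gt0 : 0 < h by apply: h_gt0.
move: sz_rows => /= /andP[/eqP sz_w sz_rows].
have := @scan_row i w l0 (bits (flatten rows)) xb h_gt0 sz_w row_xb.
have -> : bits w ++ bits (flatten rows) = bits (w ++ flatten rows).
  by rewrite -map_cat.
move=> /=; case: (row_bad i w) => /=.
  by apply: check_rejects_le; rewrite mulSn; lia.
case=> xb1 [E1 E2] H1.
have -> : rev (bits (w ++ flatten rows)) ++ l0 =
          rev (bits (flatten rows)) ++ rev (bits w) ++ l0.
  by rewrite /bits map_cat rev_cat catA.
(* After the last row no bit remains to trigger the turn: the blank behind the input starts the
   rewinding instead. *)
case: rows IH sz_rows H1 => [|w' rows] IH sz_rows H1.
  do 2!eexists; have -> : (1 * (h + h).+2).+1 = h + h.+1 + 2 by lia.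
  by apply: reach_trans H1 _; apply: reach_step (reach_refl _ _ _).
have [b [s Es]] : exists b s, flatten (w' :: rows) = b :: s.
  move: sz_rows => /= /andP[/eqP sz_w' _].
  by case: w' sz_w' {H1 IH} => [|b w'] sz_w'; [move: h_gt0 sz_w' => /=; lia|do 2!eexists].
set xb2 := tape_act xb1 (tape_read xb1, MoveL).
have row2 : row_tape i.+1 xb2.
  rewrite /row_tape /xb2 /= {1}/tape_read /= E1; case: ltnP => lt_ih.
    by have -> : h - i.+1 = (h - i.+2).+1 by lia.
  have -> : h - i.+1 = 0 by lia.
  by have -> : h - i.+2 = 0 by lia.
have := IH i.+1 (rev (bits w) ++ l0) xb2 (fun=> h_gt0) sz_rows row2.
have {}H1 : reach check_step (h + h).+2
    (Some (CScan true), ((l0, bits (w ++ flatten (w' :: rows))), col_left h, xb))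
    (Some (CScan true), ((rev (bits w) ++ l0, bits (flatten (w' :: rows))),
       col_left h, xb2)).
  have -> : (h + h).+2 = h + h.+1 + 1 by lia.
  apply: reach_trans H1 _; apply: reach_step (reach_refl _ _ _).
  by rewrite Es /= /col_right /col_left subnn.
have -> : (size (w :: w' :: rows) * (h + h).+2).+1 =
          (h + h).+2 + (size (w' :: rows) * (h + h).+2).+1.
  by rewrite /= !mulSn; lia.
move=> /=; case: (_ || _).
  exact: check_rejects_reach H1.
by case=> xa [xb' H2]; exists xa, xb'; apply: reach_trans H1 H2.
Qed.

End Scan.

Lemma rewind w r xa xb :
  exists xa' xb', reach check_step (size w).+1
    (Some CRewind, ((behead (bits w), head None (bits w) :: r), xa, xb))
    (None, (([:: None], catrev (bits w) r), xa', xb')).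
Proof.
elim: w r xa xb => [|b w IHw] r xa xb.
  by do 2!eexists; apply: reach_step (reach_refl _ _ _).
have [xa' [xb' H]] := IHw (Some (inl b) :: r) (tape_act xa (tape_read xa, MoveS))
  (tape_act xb (tape_read xb, MoveS)).
by exists xa', xb'; apply: reach_step H.
Qed.

Lemma check_run n rows : size rows = n -> all (fun w => size w == n) rows ->
  let x := nseq n true ++ false :: flatten rows in
  let c := (Some CInit, (([::], bits x), ([::], [::]), ([::], [::]))) in
  let t := 2 * n ^ 2 + 4 * n + 6 in
  if odd n || rows_bad n./2 0 rows then check_rejects t c
  else exists xa xb, reach check_step t c
         (None, (([:: None], bits x ++ [:: None]), xa, xb)).
Proof.
move=> sz_rows szs x c t; set h := n./2.
have En : n = odd n + 2 * h by rewrite mul2n odd_double_half.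
have Ebx : bits x = nseq (2 * h) mark ++ nseq (odd n) mark ++
    Some (inl false) :: bits (flatten rows).
  by rewrite /x /bits map_cat map_nseq catA -nseqD addnC -En.
have H0 : reach check_step 1 c
    (Some (CCount false), (([::], bits x), ([:: None], [::]), ([::], [:: None]))).
  apply: reach_step (reach_refl _ _ _); rewrite /c /= /tape_act /=.
  have -> // : head None (bits x) :: behead (bits x) = bits x.
  by rewrite /x; case: (n).
have [e] := count_pairs h 0 1 [::] (nseq (odd n) mark ++
    Some (inl false) :: bits (flatten rows)).
rewrite -Ebx !addn0 cats0 => /(reach_trans H0) {}H0.
case: (boolP (odd n)) En Ebx H0 => /= [_|even_n] En Ebx H0.
  (* Two more steps: the unpaired mark flips the parity, then the separator is overwritten by a mark
     and the machine halts on it. *)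
  apply: (@check_rejects_le (1 + 2 * h + 2)); first by rewrite /t; lia.
  apply: check_rejects_reach H0 _; eexists; split.
  - by apply: reach_step; last (apply: reach_step; last exact: reach_refl).
  - by [].
  - by [].
have {}H0 : reach check_step (2 * h + 2) c
    (Some (CScan true),
     ((Some (inl false) :: nseq (2 * h) mark, bits (flatten rows)),
      col_left h h, tape_act (nseq h mark, nseq e None) (None, MoveL))).
  have -> : 2 * h + 2 = 1 + 2 * h + 1 by lia.
  apply: reach_trans H0 _; apply: reach_step (reach_refl _ _ _).
  by rewrite /= /col_left subnn; case: (e).
have h_gt0 : rows != [::] -> 0 < h.
  by rewrite -size_eq0 sz_rows; lia.
have szs' : all (fun w => size w == h + h) rows.
  by move: szs; rewrite {1}En add0n mul2n -addnn.
have row0 : row_tape h 0 (tape_act (nseq h mark, nseq e None) (None, MoveL)).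
  by rewrite /row_tape /tape_read /= subn1; case: (h).
have /= := scan_rows (Some (inl false) :: nseq (2 * h) mark) h_gt0 szs' row0.
(* Counting takes n + 2 steps, the scan n (n + 2) + 1 and the rewinding n + n^2 + 2, in all 2 n^2 +
   4 n + 5. *)
have le_t : 2 * h + 2 + (size rows * (h + h).+2).+1 + (size x).+1 <= t.
  rewrite /x size_cat size_nseq /= size_flatten /shape (_ : sumn _ = n ^ 2); last first.
    have /all_pred1P -> : all (pred1 n) (map size rows) by rewrite all_map.
    by rewrite size_map sz_rows sumn_nseq mulnn.
  by rewrite sz_rows /t; move: (n ^ 2) (mulnn n); nia.
case: ifP => _.
  move=> /(check_rejects_reach H0); apply: check_rejects_le.
  by apply: leq_trans le_t; rewrite leq_addr.
case=> xa [xb /(reach_trans H0) {}H0].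
have El : rev (bits (flatten rows)) ++ Some (inl false) :: nseq (2 * h) mark =
    bits (rev x).
  rewrite /bits map_rev -/(bits x) Ebx rev_cat rev_cons cat_rcons.
  by congr (_ ++ _ :: _); rewrite rev_nseq.
have [xa' [xb' H1]] := rewind (rev x) [:: None] xa xb.
exists xa', xb'; apply: reach_le le_t _; apply: reach_trans H0 _.
by rewrite El; move: H1; rewrite size_rev /bits map_rev catrevE revK.
Qed.

End Check.

(** * The scan decides bipartiteness along the halves *)

Lemma card_set2I (T : finType) (S : {set T}) u v : u != v ->
  (#|[set u; v]%SET :&: S| == 1) = ((u \in S) != (v \in S)).
Proof.
move=> uv; rewrite finset.setIC finset.setIUr cardsU.
have E1 w : #|S :&: [set w]%SET| = (w \in S).
  have [wS|wS] := boolP (w \in S).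
    by rewrite (finset.setIidPr _) ?cards1 // finset.sub1set.
  by apply/eqP; rewrite cards_eq0 finset.setI_eq0 disjoint_sym disjoints1.
rewrite !E1 (_ : _ :&: _ :&: _ = finset.set0) ?cards0 ?subn0; last first.
  apply/finset.setP => w; rewrite !inE.
  by case: eqVneq => [->|]; rewrite ?andbF // (negPf uv) !andbF.
by case: (u \in S); case: (v \in S).
Qed.

Lemma rows_badPn h i rows :
  reflect (forall r, r < size rows -> ~~ row_bad h (i + r) (nth [::] rows r))
          (~~ rows_bad h i rows).
Proof.
elim: rows i => [|w rows IH] i /=; first by constructor.
rewrite negb_or; apply: (iffP andP) => [[Hw /IH Hr] [|r] lt_r|H].
- by rewrite addn0.
- by rewrite addnS -addSn; apply: Hr.
split; first by have := H 0 isT; rewrite addn0.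
by apply/IH => r lt_r; rewrite addSnnS; apply: (H r.+1).
Qed.

Definition matrix_rows n (E : sgraph n) : seq (seq bool) :=
  [seq [seq [set i; j] \in E | j <- enum 'I_n] | i <- enum 'I_n].

(** Simplicity enters twice: an entry equal to [true] is off the diagonal, so a bad row yields an
    edge with both ends in one half; and every edge is a pair, so it occurs as an entry. *)
Lemma bipartite_by_rows n (E : sgraph n) : simple_graph E ->
  bipartite_by (left_half n) E = ~~ rows_bad n./2 0 (matrix_rows E).
Proof.
move=> /forall_inP sE; set S := left_half n; set h := n./2.
have inS v : (v \in S) = (v < h) by rewrite inE.
have bad (i : 'I_n) : row_bad h i [seq [set i; j] \in E | j <- enum 'I_n] =
    [exists j : 'I_n, ((i \in S) == (j \in S)) && ([set i; j] \in E)].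
  rewrite /row_bad -map_take -map_drop -fun_if has_map.
  apply/hasP/existsP => [[j Hj /= ijE]|[j /andP[Hj ijE]]]; exists j => //.
    rewrite ijE andbT !inS; move: Hj; case: ltnP => _ Hj.
      by move: Hj; rewrite in_take ?mem_enum // index_enum_ord => ->.
    have := enum_uniq 'I_n; rewrite -{1}(cat_take_drop h (enum _)) cat_uniq.
    by move=> /and3P[_ /hasPn /(_ j Hj)]; rewrite /= in_take ?mem_enum // index_enum_ord => /negPf ->.
  move: Hj; rewrite !inS; case: ltnP => _ /eqP Hj.
    by rewrite in_take ?mem_enum // index_enum_ord -Hj.
  have: j \in take h (enum 'I_n) ++ drop h (enum 'I_n).
    by rewrite cat_take_drop mem_enum.
  by rewrite mem_cat in_take ?mem_enum // index_enum_ord -Hj.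
apply/forall_inP/rows_badPn => [bE r|H e eE].
  rewrite size_map size_enum_ord => lt_r.
  rewrite (nth_map (Ordinal lt_r)) ?size_enum_ord // add0n.
  have -> : nth (Ordinal lt_r) (enum 'I_n) r = Ordinal lt_r.
    by apply: val_inj; rewrite /= nth_enum_ord.
  rewrite (bad (Ordinal lt_r)); apply/existsPn => j; apply/negP => /andP[Hj ijE].
  have ne : Ordinal lt_r != j.
    by apply/eqP => Ej; have := sE _ ijE; rewrite Ej finset.setUid cards1.
  by have := bE _ ijE; rewrite card_set2I // Hj.
have /cards2P[u [v [uv Ee]]] := sE e eE.
have := H (u : nat); rewrite size_map size_enum_ord ltn_ord => /(_ isT).
rewrite (nth_map u) ?size_enum_ord // add0n nth_ord_enum bad => /existsPn /(_ v).
by rewrite -Ee eE andbT Ee card_set2I.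
Qed.

(** * Running the check ahead of a given machine *)

Section Guard.
Variable T : turing_machine.
Let N := tm_tapes T.
Let col : 'I_N.+3 := inord N.+1.
Let row : 'I_N.+3 := ord_max.
Let old (i : 'I_N.+1) : 'I_N.+3 := widen_ord (leqW (leqnSn N.+1)) i.

Let val_col : val col = N.+1.
Proof. by rewrite /col /= inordK. Qed.

Definition guard_trans (s : check_state + tm_state T)
    (g : {ffun 'I_N.+3 -> symbol (tm_work T)}) :
    option ((check_state + tm_state T) *
            {ffun 'I_N.+3 -> symbol (tm_work T) * move}) :=
  match s with
  | inl q =>
      if check_trans q (g ord0) (g col) (g row) is Some (q', (w0, wa, wb))
      then Some (if q' is Some q1 then inl q1 else inr (tm_start T),
                 [ffun i => if i == ord0 then w0 else if i == col then wa
                            else if i == row then wb else (g i, MoveS)])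
      else None
  | inr q =>
      if tm_trans q [ffun i => g (old i)] is Some (q', act)
      then Some (inr q', [ffun j : 'I_N.+3 =>
                   if insub (j : nat) is Some i then act i else (g j, MoveS)])
      else None
  end.

Definition guard_tm := TuringMachine (inl CInit) guard_trans.

(** The idle tapes are rewritten with the blanks they scan, so they stay empty only up to
    [tape_eq]. *)
Let check_sim (c : check_config (tm_work T)) (e : tm_config guard_tm) : Prop :=
  [/\ e.1 = (if c.1 is Some q then inl q else inr (tm_start T)),
      e.2 ord0 = c.2.1.1, e.2 col = c.2.1.2, e.2 row = c.2.2 &
      forall i, i != ord0 -> i != col -> i != row -> tape_eq (e.2 i) ([::], [::])].

Let col0 : (col == ord0) = false.
Proof. by rewrite -val_eqE val_col. Qed.

Let row0 : (row == ord0) = false.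
Proof. by []. Qed.

Let row_col : (row == col) = false.
Proof. by rewrite -val_eqE val_col /= eqn_leq ltnn. Qed.

Lemma check_simulation c e c1 : check_sim c e -> check_step c = Some c1 ->
  exists2 e1, tm_step e = Some e1 & check_sim c1 e1.
Proof.
case: c => [[q|] [[x0 xa] xb]] //= [E1 E2 E3 E4 E5]; rewrite /tm_step E1 /= !ffunE E2 E3 E4 /=.
case: (check_trans _ _ _ _) => // -[q' [[w0 wa] wb]] [<-].
eexists; first by reflexivity.
split=> //=; rewrite ?ffunE ?eqxx ?col0 ?row0 ?row_col ?E2 ?E3 ?E4 //.
move=> i i0 ic ir; rewrite !ffunE (negPf i0) (negPf ic) (negPf ir).
have Hi := E5 i i0 ic ir.
have := tape_eq_act (tape_read (e.2 i), MoveS) Hi.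
by rewrite (tape_eq_read Hi) => -[H1 H2]; split=> j; rewrite ?H1 ?H2; case: j => [|[|j]].
Qed.

Let run_sim (c : tm_config T) (e : tm_config guard_tm) : Prop :=
  e.1 = inr c.1 /\ forall i, tape_eq (e.2 (old i)) (c.2 i).

Let run_sim_reads c (e : tm_config guard_tm) : run_sim c e ->
  [ffun i => [ffun j => tape_read (e.2 j)] (old i)] =
  [ffun i => tape_read (c.2 i)].
Proof. by move=> [_ H]; apply/ffunP => i; rewrite !ffunE (tape_eq_read (H i)). Qed.

Lemma run_simulation c e c1 : run_sim c e -> tm_step c = Some c1 ->
  exists2 e1, tm_step e = Some e1 & run_sim c1 e1.
Proof.
move=> Hs; have Er := run_sim_reads Hs; case: Hs => E1 E2.
rewrite /tm_step E1 /= Er; case: (tm_trans _ _) => // -[q' act] [<-].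
eexists; first by reflexivity.
split=> //= i; rewrite ffunE /= insubT // => lt_i.
rewrite (_ : Sub _ _ = i); last exact: val_inj.
exact: tape_eq_act.
Qed.

Lemma run_sim_halted c e : run_sim c e -> tm_step c = None -> tm_step e = None.
Proof.
move=> Hs; have Er := run_sim_reads Hs; case: Hs => E1 E2.
by rewrite /tm_step E1 /= Er; case: (tm_trans _ _) => [[]|].
Qed.

Lemma guard_tm_computes n (E : sgraph n) t y : simple_graph E ->
  tm_computes T t (encode_graph E) y ->
  exists2 y', tm_computes guard_tm (2 * n ^ 2 + 4 * n + 6 + t) (encode_graph E) y' &
    if ~~ odd n && bipartite_by (left_half n) E then y' = y
    else head false y'.
Proof.
move=> sE [Hh Hy]; set x := encode_graph E in Hh Hy *.
have szr : size (matrix_rows E) = n by rewrite size_map size_enum_ord.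
have szs : all (fun w => size w == n) (matrix_rows E).
  by apply/allP => _ /mapP[i _ ->]; rewrite size_map size_enum_ord.
have := check_run (tm_work T) szr szs.
rewrite -/(encode_graph E) -/x /= -[odd n || _]negbK negb_or -bipartite_by_rows //.
set c0 := (Some CInit, _).
have sim0 : check_sim c0 (tm_init guard_tm x).
  by split=> //= [|i /negPf ->]; rewrite ?col0.
case: (_ && _) => /=.
  case=> xa [xb H]; have [e1 H1 [E1 E2 E3 E4 E5]] := simulate check_simulation sim0 H.
  (* The check leaves an explicit blank at either end of the input, so [T] starts from its initial
     configuration up to [tape_eq]. *)
  have sim1 : run_sim (tm_init T x) e1.
    split=> // i /=; case: eqVneq => [->|i0].
      rewrite (_ : old ord0 = ord0); last exact: val_inj.
      rewrite E2 /=; split=> /= j; first by case: j => [|[]].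
      by rewrite nth_cat; case: ltnP => // le_j; rewrite (nth_default _ le_j); case: (_ - _) => [|[]].
    have lt_i := ltn_ord i.
    apply: E5; rewrite -val_eqE /= ?val_col.
    - by move: i0; rewrite -val_eqE.
    - by rewrite ltn_eqF.
    - by rewrite ltn_eqF // leqW.
  have [e2 H2 sim2] := simulate run_simulation sim1 (reach_tm_run t _).
  exists y => //; rewrite /tm_computes.
  rewrite (tm_run_reach (reach_trans H1 H2) (run_sim_halted sim2 Hh)).
  split; first exact: run_sim_halted sim2 Hh.
  rewrite -Hy /tm_output; apply: leading_bits_eq.
  by have [_ /(_ ord0)[_]] := sim2; rewrite (_ : old ord0 = ord0) //; apply: val_inj.
case=> c [H Hc [Hr Hc1]]; have [e1 H1 [E1 E2 E3 E4 E5]] := simulate check_simulation sim0 H.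
have He1 : tm_step e1 = None.
  case: c Hc Hc1 E1 E2 E3 E4 {H Hr} => [[q|] [[x0 xa] xb]] //= Hc _ E1 E2 E3 E4.
  rewrite /tm_step E1 /= !ffunE E2 E3 E4 /=; move: Hc.
  by case: (check_trans _ _ _ _) => [[? [[? ?] ?]]|].
exists (tm_output e1).
  rewrite /tm_computes (tm_run_reach _ He1) //.
  by apply: reach_le H1; rewrite leq_addr.
rewrite /tm_output E2; move: Hr; rewrite /tape_read.
by case: (c.2.1.1).2 => //= a r ->.
Qed.

End Guard.

Lemma poly_time_bipartite_guard (F : graph_fun) : poly_time F ->
  exists2 F' : graph_fun, poly_time F' &
    forall n (E : sgraph n), simple_graph E ->
      if ~~ odd n && bipartite_by (left_half n) E then F' n E = F n E
      else head false (F' n E).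
Proof.
move=> [T [a [b H]]].
apply: (poly_time_witness
  (P := fun n E y => if ~~ odd n && bipartite_by (left_half n) E then y = F n E
                     else head false y)
  (T := guard_tm T) (a := 2 * a + 12) (b := b + 2)) => n E sE.
have [y [Hh Ho] Py] := guard_tm_computes sE (H n E sE).
exists y => //.
(* Bounding n, n^2 and n^b by n^(b+2) + 1 gives (a + 6) n^(b+2) + 2 a + 12. *)
suff le_t : 2 * n ^ 2 + 4 * n + 6 + (a * n ^ b + a) <=
     (2 * a + 12) * n ^ (b + 2) + (2 * a + 12).
  have Hr := reach_le le_t (reach_tm_run _ (tm_init (guard_tm T) (encode_graph E))).
  by rewrite /tm_computes (tm_run_reach Hr Hh).
have := @expn_le_add n 1 (b + 2) ltac:(lia).
have := @expn_le_add n 2 (b + 2) ltac:(lia).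
have := @expn_le_add n b (b + 2) ltac:(lia).
rewrite expn1; move: (n ^ b) (n ^ (b + 2)) (n ^ 2) => u v w; nia.
Qed.

(** * Comparing a printed rational with a constant *)

Section DecodeAutomaton.
Local Open Scope ring_scope.
Variable q : rat.

(** This is |[num_coef]| + |[den_coef]| + 1. A carry of size at most [K] grows to at most 2 [K] - 1
    over one bit of each number, and halving with rounding up brings it back to at most [K]; so
    finitely many carries suffice. *)
Let K : nat := (`|numq q| + `|denq q|).+1.
Let carry (i : 'I_(4 * K).+1) : int := (i : nat)%:Z - (2 * K)%:Z.
Let encode_carry (z : int) : 'I_(4 * K).+1 := inord (absz (z + (2 * K)%:Z)).

Let carryK z : `|z| <= (2 * K)%:Z -> carry (encode_carry z) = z.
Proof.
move=> Hz; rewrite /carry /encode_carry inordK; first by lia.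
by rewrite ltnS; lia.
Qed.

Let num_coef (sg : bool) : int := if sg then - denq q else denq q.
Let den_coef : int := - numq q.

(* With num_coef * N + den_coef * (D + 1) > 0 as the property to decide, for N
   and D read in parallel from the least significant bit, the state is the sign,
   the kind of the next bit, and a carry: as N and D are integers,
   c + 2 (a N + b D) > 0 if and only if ceil (c / 2) + a N + b D > 0. *)
Definition decode_next (s : option (bool * bool * 'I_(4 * K).+1)) (x : bool) :
    option (bool * bool * 'I_(4 * K).+1) :=
  match s with
  | None => Some (x, false, encode_carry den_coef)
  | Some (sg, false, i) =>
      Some (sg, true, encode_carry (carry i + num_coef sg * x%:Z))
  | Some (sg, true, i) =>
      Some (sg, false, encode_carry ((carry i + den_coef * x%:Z + 1) %/ 2)%Z)
  end.

(** Missing digits are zeros, so at the end of the input the carry alone decides. The empty string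
    denotes 0, and [0 < den_coef] says that [q] is negative. *)
Definition decode_acc (s : option (bool * bool * 'I_(4 * K).+1)) : bool :=
  if s is Some (_, _, i) then 0 < carry i else 0 < den_coef.

Let num t : int := (bits_to_nat (even_bits t))%:Z.

Let num_cons x t : num (x :: t) = x%:Z + 2 * num (behead t).
Proof. by rewrite /num; case: t => [|y t] /=; lia. Qed.

(** Each bit read exchanges the roles of the two interleaved numbers, so both parities are proved
    together. In the second, the remaining bits of the numerator weigh twice as much, its current
    bit being already consumed. *)
Lemma decode_run t sg i :
  (`|carry i| <= K%:Z ->
   decode_acc (foldl decode_next (Some (sg, false, i)) t) =
   (0 < carry i + num_coef sg * num t + den_coef * num (behead t))) /\
  (`|carry i| <= K%:Z + `|num_coef sg| ->
   decode_acc (foldl decode_next (Some (sg, true, i)) t) =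
   (0 < carry i + den_coef * num t + 2 * num_coef sg * num (behead t))).
Proof.
have Ha : `|num_coef sg| + `|den_coef| + 1 = K%:Z.
  by rewrite /num_coef /den_coef /K; case: sg; lia.
elim: t i => [|x t IHt] i; first by rewrite /num /= !mulr0 !addr0.
have Hax : `|num_coef sg * x%:Z| <= `|num_coef sg| by case: (x); rewrite ?mulr1 ?mulr0 ?normr0.
have Hbx : `|den_coef * x%:Z| <= `|den_coef| by case: (x); rewrite ?mulr1 ?mulr0 ?normr0.
split=> Hi /=; rewrite num_cons.
  have Hc : `|carry i + num_coef sg * x%:Z| <= K%:Z + `|num_coef sg| by lia.
  by rewrite (IHt _).2 carryK //; [congr (0 < _); ring|lia|lia].
set z := carry i + den_coef * x%:Z.
have Hc : `|((z + 1) %/ 2)%Z| <= K%:Z by rewrite /z; lia.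
by rewrite (IHt _).1 carryK //; lia.
Qed.

Lemma decode_acc_correct (R : realType) s :
  decode_acc (foldl decode_next None s) = (ratr q < decode_num R s).
Proof.
pose sg := head false s; pose t := behead s.
have -> : decode_acc (foldl decode_next None s) =
    (0 < den_coef + num_coef sg * num t + den_coef * num (behead t)).
  rewrite /sg /t; case: s {sg t} => [|b t] /=.
    by rewrite /num /= !mulr0 !addr0.
  have Hd : `|den_coef| <= K%:Z by rewrite /den_coef /K; lia.
  by rewrite (decode_run t b _).1 carryK //; lia.
rewrite /decode_num -/sg -/t /ratr.
set n1 := bits_to_nat (even_bits t); set n2 := bits_to_nat (even_bits (behead t)).
have r_gt0 : 0 < (denq q)%:~R :> R by rewrite ltr0z denq_gt0.
have d_gt0 : 0 < n2.+1%:R :> R by [].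
rewrite ltr_pdivrMr // mulrAC ltr_pdivlMr //.
rewrite -[RHS]subr_gt0 -(ltr0z R) /num -/n1 -/n2; apply: (congr1 (fun z : R => 0 < z)).
rewrite /num_coef /den_coef -natr1 !rmorphD !rmorphM /= !rmorphN /=.
by case: sg; rewrite /= ?rmorphN /= ?expr1 ?expr0 -!pmulrn; ring.
Qed.

End DecodeAutomaton.

Lemma poly_time_threshold (R : realType) (q : rat) (F : graph_fun) :
  poly_time F ->
  exists2 F' : graph_fun, poly_time F' &
    forall n (E : sgraph n), simple_graph E ->
      head false (F' n E) = (ratr q < decode_num R (F n E))%R.
Proof.
move=> HF; have [F' HF' H] :=
  poly_time_dfa None (@decode_next q) (@decode_acc q) HF.
by exists F' => // n E sE; rewrite H // (decode_acc_correct q R).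
Qed.

(** * From certificates to detection *)

Local Open Scope ring_scope.

Lemma tends_alongP (R : realType) (A : set nat) (u : nat -> R) (l : R) :
  tends_along A u l <->
  forall e, 0 < e -> exists N, forall n, (N <= n)%N -> A n -> `|l - u n| < e.
Proof.
split=> [H e e_gt0|H].
  have /cvgrPdist_lt /(_ e e_gt0) [N _ HN] := H.
  by exists N => n le_N An; apply: HN.
apply/cvgrPdist_lt => e /H [N HN]; exists N => // n /= le_N An; exact: HN.
Qed.

(** * Finite laws *)

Lemma unif_ge0 (R : realType) (T : finType) (A : {set T}) x : 0 <= unif R A x.
Proof. by rewrite /unif divr_ge0. Qed.

Lemma unif_eq0 (R : realType) (T : finType) (A : {set T}) x :
  x \notin A -> unif R A x = 0.
Proof. by rewrite /unif => /negPf ->; rewrite mul0r. Qed.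

Lemma sum_unif (R : realType) (T : finType) (A : {set T}) :
  \sum_x unif R A x = (A != finset.set0)%:R.
Proof.
have -> : \sum_x unif R A x = #|A|%:R / #|A|%:R.
  rewrite -mulr_suml -natr_sum; congr (_%:R / _).
  by rewrite -sum1_card [RHS]big_mkcond; apply: eq_bigr => x _; case: (x \in A).
have [->|An0] := eqVneq A finset.set0; first by rewrite cards0 mul0r.
by rewrite divff // pnatr_eq0 cards_eq0.
Qed.

Lemma PrC (R : realType) (T : finType) (mu : T -> R) (P : pred T) :
  Pr mu P + Pr mu (predC P) = \sum_x mu x.
Proof. by rewrite [RHS](bigID P). Qed.

Lemma Pr_ge0 (R : realType) (T : finType) (mu : T -> R) (P : pred T) :
  (forall x, 0 <= mu x) -> 0 <= Pr mu P.
Proof. by move=> H; apply: sumr_ge0. Qed.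

Lemma sub_Pr (R : realType) (T : finType) (mu : T -> R) (P Q : pred T) :
  (forall x, 0 <= mu x) -> (forall x, P x -> mu x != 0 -> Q x) -> Pr mu P <= Pr mu Q.
Proof.
move=> mu_ge0 PQ; rewrite /Pr big_mkcond [leRHS]big_mkcond.
apply: ler_sum => x _; case Px: (P x); case Qx: (Q x) => //.
by have [->//|/(PQ x Px)] := eqVneq (mu x) 0; rewrite Qx.
Qed.

(** * Error probabilities of the distinguisher *)

Section Detection.
Variables (R : realType) (d : nat) (f : forall n, sgraph n -> R).

Lemma null_error (space : forall n, {set sgraph n}) (B q : R) (F G : graph_fun)
    (k : nat) (A : set nat) : (0 < k)%N -> B < q ->
  certifies_whp d f space B F ->
  (forall n (E : sgraph n), E \in space n ->
     head false (G n E) = (q < decode_num R (F n E))) ->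
  tends_along A (fun m => Pr (unif R (space (k * m)%N))
                             (fun E => head false (G (k * m)%N E))) 0.
Proof.
move=> k_gt0 ltBq [_ /tends_alongP H] HG; apply/tends_alongP => e e_gt0.
have [N HN] := H e e_gt0; exists N => m le_Nm _; set n := (k * m)%N.
have le_Nn : (N <= n)%N by rewrite (leq_trans le_Nm) // leq_pmull.
have Hge0 := @unif_ge0 R _ (space n).
rewrite sub0r normrN ger0_norm ?Pr_ge0 //.
(* At sizes without such graphs the uniform law is identically zero, since division by zero gives 0,
   and so is the error. *)
have [E0|En0] := eqVneq (space n) finset.set0.
  rewrite (_ : Pr _ _ = 0); first by [].
  by apply: big1 => E _; rewrite unif_eq0 // E0 inE.
apply: le_lt_trans (HN n le_Nn En0).
apply: le_trans (ler_norm _).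
have E1 := PrC (unif R (space n)) (fun E => decode_num R (F n E) <= B).
rewrite sum_unif En0 in E1; rewrite -[1]/(true%:R) -E1 addrAC subrr add0r.
apply: sub_Pr => // E HE uE /=; rewrite -ltNge (lt_trans ltBq) // -HG //.
by apply: contraNT uE => /unif_eq0 ->.
Qed.

(** The common ground of random and adversarial noise. Mass at most 1 is asked because [unif] of an
    empty set of deletions or additions is the zero law. *)
Definition admissible_kernel k (M : 'M[nat]_k) (lab : labelling k) (eps : R)
    (ok : forall m, lift_config k d m -> pred (sgraph (k * m)))
    (K : noise_kernel R k d) : Prop :=
  forall m (x : lift_config k d m), x \in lift_space d M lab m ->
    [/\ forall E', 0 <= K m x E', \sum_E' K m x E' <= 1 &
        forall E', K m x E' != 0 ->
          [&& regular_graph d E', Delta R (lift_graph x) E' <= eps & ok m x E']].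

(** On a robust lift a missed outcome would give c <= f <= certified bound <= q < c, so the error is
    at most the probability that the lift is not robust. [ok'] is what the noise guarantees, [ok]
    what robustness covers; the test must bridge the two on the graphs it does not flag. *)
Lemma planted_error k (M : 'M[nat]_k) (lab : labelling k) (eps : R)
    (ok ok' : forall m, lift_config k d m -> pred (sgraph (k * m)))
    (K : noise_kernel R k d) (c q : R) (F G : graph_fun) : q < c ->
  (forall n (E : sgraph n), regular_graph d E -> f E <= decode_num R (F n E)) ->
  tends_along (lift_sizes d M lab)
    (fun m => Pr (unif R (lift_space d M lab m))
      (fun x => [forall E' : sgraph (k * m),
         [&& regular_graph d E', Delta R (lift_graph x) E' <= eps & ok m x E'] ==>
         (c <= f E')])) 1 ->
  admissible_kernel M lab eps ok' K ->
  (forall m (x : lift_config k d m) E', x \in lift_space d M lab m ->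
     regular_graph d E' -> ok' m x E' -> ~~ head false (G (k * m)%N E') ->
     ok m x E' && (decode_num R (F (k * m)%N E') <= q)) ->
  tends_along (lift_sizes d M lab)
    (fun m => Pr (noisy_lift M lab K (m := m))
      (fun E => ~~ head false (G (k * m)%N E))) 0.
Proof.
move=> ltqc HF /tends_alongP H HK HG; apply/tends_alongP => e e_gt0.
have [N HN] := H e e_gt0; exists N => m le_Nm m_size.
pose rob (x : lift_config k d m) := [forall E' : sgraph (k * m),
  [&& regular_graph d E', Delta R (lift_graph x) E' <= eps & ok m x E'] ==>
  (c <= f E')].
have {}HN : `|1 - Pr (unif R (lift_space d M lab m)) rob| < e := HN m le_Nm m_size.
have Hge0 := @unif_ge0 R _ (lift_space d M lab m).
apply: le_lt_trans HN.
have E1 := PrC (unif R (lift_space d M lab m)) rob.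
rewrite sum_unif (m_size : _ != _) in E1.
rewrite sub0r normrN -[1]/(true%:R) -E1 addrAC subrr add0r [leRHS]ger0_norm ?Pr_ge0 //.
have EP : Pr (noisy_lift M lab K (m := m)) (fun E => ~~ head false (G (k * m)%N E)) =
    \sum_x unif R (lift_space d M lab m) x *
      \sum_(E' | ~~ head false (G (k * m)%N E')) K m x E'.
  rewrite /Pr /noisy_lift exchange_big /=; apply: eq_bigr => x _.
  by rewrite mulr_sumr.
rewrite EP ger0_norm; last first.
  apply: sumr_ge0 => x _; have [xs|/unif_eq0 ->] := boolP (x \in lift_space d M lab m);
    last by rewrite mul0r.
  by rewrite mulr_ge0 //; apply: sumr_ge0 => E _; have [] := HK m x xs.
rewrite /Pr [leRHS]big_mkcond /=; apply: ler_sum => x _.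
have [xs|/unif_eq0 ->] := boolP (x \in lift_space d M lab m); last first.
  by rewrite mul0r if_same.
have [K0 K1 Ks] := HK m x xs.
case: (boolP (rob x)) => /= [/forallP rx|_]; last first.
  rewrite -[leRHS]mulr1 ler_wpM2l // (le_trans _ K1) //.
  by rewrite [leRHS](bigID (fun E => ~~ head false (G (k * m)%N E))) /= lerDl sumr_ge0.
rewrite big1 ?mulr0 // => E' HE'; apply/eqP; apply: contraT => /Ks /and3P[rE' dE' oE'].
have /andP[oE1 le_q] := HG m x E' xs rE' oE' HE'.
have := rx E'; rewrite rE' dE' oE1 /= => le_c.
by have := le_lt_trans (le_trans le_c (le_trans (HF _ _ rE') le_q)) ltqc; rewrite ltxx.
Qed.

(** An adversary is bound on all labellings, and restricting the labelling only shrinks the lift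
    space. *)
Lemma adversary_admissible k (M : 'M[nat]_k) (lab : labelling k) (eps : R)
    (ok : forall m, lift_config k d m -> pred (sgraph (k * m)))
    (K : noise_kernel R k d) :
  adversary M eps ok K -> admissible_kernel M lab eps ok K.
Proof.
move=> H m x; rewrite inE => /and4P[H1 H2 H3 H4].
have [|K0 K1 Ks] := H m x; first by rewrite inE /any_labelling H1 H3 H4.
by split=> //; rewrite K1.
Qed.

(** The symmetric difference lies in [D :|: A], of size at most 2 eps n, and [Delta] divides by
    2n. *)
Lemma Delta_rewire n (E D A : sgraph n) (eps : R) : 0 <= eps ->
  D \in deletions eps E -> #|A| = #|D| -> Delta R E ((E :\: D) :|: A) <= eps.
Proof.
move=> eps0; rewrite inE => /andP[sDE /eqP cD] cA; rewrite /Delta.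
have [n0|n_gt0] := posnP n; first by rewrite (_ : n%:R = 0 :> R) ?mulr0 ?invr0 ?mulr0 // n0.
have n0 : 0 < n%:R :> R by rewrite ltr0n.
rewrite ler_pdivrMr ?mulr_gt0 //.
have le_card : (#|(E :\: ((E :\: D) :|: A)) :|: (((E :\: D) :|: A) :\: E)| <= #|D| + #|D|)%N.
  rewrite -{2}cA; apply: leq_trans (leq_card_setU D A).1.
  apply: subset_leq_card; apply/fintype.subsetP => e; rewrite !inE.
  by case: (e \in E); case: (e \in D); case: (e \in A).
apply: (@le_trans _ _ (#|D| + #|D|)%:R); first by rewrite ler_nat.
have : #|D|%:R <= eps * n%:R.
  apply: le_trans (_ : (Num.truncn (eps * n%:R))%:R <= _); last by rewrite truncn_le mulr_ge0.
  by rewrite ler_nat cD geq_minl.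
by rewrite natrD; lra.
Qed.

Lemma random_kernel_admissible k (M : 'M[nat]_k) (lab : labelling k) (eps : R)
    (okA : forall m, fibering k m -> pred (sgraph (k * m)))
    (ok : forall m, lift_config k d m -> pred (sgraph (k * m))) :
  0 <= eps ->
  (forall m (x : lift_config k d m) D A, x \in lift_space d M lab m ->
     okA m x.1 A -> ok m x ((lift_graph x :\: D) :|: A)) ->
  admissible_kernel M lab eps ok (@random_kernel R k d eps okA).
Proof.
move=> eps0 Hok m x xs; rewrite /random_kernel; set E := lift_graph x.
split.
- move=> E'; apply: sumr_ge0 => D _; rewrite mulr_ge0 ?unif_ge0 //.
  by apply: sumr_ge0 => A _; rewrite mulr_ge0 ?unif_ge0.
- rewrite exchange_big /= (le_trans _ (_ : \sum_D unif R (deletions eps E) D <= 1)) //;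
    last by rewrite sum_unif lern1 leq_b1.
  apply: ler_sum => D _; rewrite -mulr_sumr ler_piMr ?unif_ge0 //.
  rewrite exchange_big /= (le_trans _ (_ : \sum_A unif R (additions d (okA m x.1) E D) A <= 1)) //;
    last by rewrite sum_unif lern1 leq_b1.
  apply: ler_sum => A _; rewrite -mulr_sumr ler_piMr ?unif_ge0 //.
  rewrite (bigD1 (E :\: D :|: A)) //= eqxx big1 ?addr0 // => E' /negPf.
  by rewrite eq_sym => ->.
move=> E' nz.
have [D HD] : exists D, unif R (deletions eps E) D *
      \sum_A unif R (additions d (okA m x.1) E D) A * (E :\: D :|: A == E')%:R != 0.
  apply/existsP; apply: contraNT nz => /existsPn H.
  by rewrite big1 // => D _; apply/eqP; have := H D; rewrite negbK.
rewrite mulf_eq0 negb_or in HD; case/andP: HD => uD HD.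
have [A HA] : exists A, unif R (additions d (okA m x.1) E D) A * (E :\: D :|: A == E')%:R != 0.
  apply/existsP; apply: contraNT HD => /existsPn H.
  by rewrite big1 // => A _; apply/eqP; have := H A; rewrite negbK.
rewrite mulf_eq0 negb_or in HA; case/andP: HA => uA; rewrite pnatr_eq0 eqb0 negbK => /eqP EE'.
have {}HD : D \in deletions eps E by apply: contraNT uD => /unif_eq0 ->.
have : A \in additions d (okA m x.1) E D by apply: contraNT uA => /unif_eq0 ->.
rewrite inE => /and4P[/eqP cA dA rA oA]; rewrite -EE' rA Delta_rewire //=.
exact: Hok.
Qed.

(** Slots list each pair of fibers in increasing order only, while an edge is an unordered set;
    symmetry of [M] supplies the other order. *)
Lemma fiber_edge k (M : 'M[nat]_k) (lab : labelling k) m (x : lift_config k d m) e :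
  mregular d M -> x \in lift_space d M lab m -> e \in lift_graph x ->
  exists u v, [/\ u != v, e = [set u; v]%SET, M (x.1 u) (x.1 v) != 0%N &
                  M (x.1 v) (x.1 u) != 0%N].
Proof.
move=> [symM _]; rewrite inE => /and4P[_ _ /forallP Hs _] /bigcupP[s _ es].
have := Hs s; case: ifP => [/andP[_ lt_s]|_ /eqP E0]; last by rewrite E0 inE in es.
case/andP=> /forall_inP /(_ e es) /existsP[u /existsP[v]] /and4P[uv /eqP Ee /eqP Eu /eqP Ev] _.
have Muv : M (x.1 u) (x.1 v) != 0%N by rewrite Eu Ev -lt0n (leq_ltn_trans _ lt_s).
exists u, v; split=> //.
by rewrite -symM mxE.
Qed.

Lemma set2_inj (T : finType) (u v u' v' : T) : u != v ->
  [set u; v]%SET = [set u'; v']%SET -> (u' = u /\ v' = v) \/ (u' = v /\ v' = u).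
Proof.
move=> uv E.
have := finset.set21 u v; have := finset.set22 u v; rewrite E !inE.
by case/orP=> /eqP Ev; case/orP=> /eqP Eu; subst; rewrite ?eqxx // in uv *; auto.
Qed.

Lemma lift_graph_respects k (M : 'M[nat]_k) (lab : labelling k) m
    (x : lift_config k d m) :
  mregular d M -> x \in lift_space d M lab m -> respects M x.1 (lift_graph x).
Proof.
move=> rM xs; apply/forallP => u; apply/forallP => v; apply/implyP => uvE.
have [u' [v' [uv' Ee M1 M2]]] := fiber_edge rM xs uvE.
by case: (set2_inj uv' (esym Ee)) => -[-> ->].
Qed.

Lemma respectsU k (M : 'M[nat]_k) m (phi : fibering k m) (E E' : sgraph (k * m)) :
  respects M phi E -> respects M phi E' -> respects M phi (E :|: E').
Proof.
move=> /forallP H /forallP H'; apply/forallP => u; apply/forallP => v.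
apply/implyP; rewrite inE => /orP[] uvE.
  by have /forallP/(_ v)/implyP/(_ uvE) := H u.
by have /forallP/(_ v)/implyP/(_ uvE) := H' u.
Qed.

Lemma respectsS k (M : 'M[nat]_k) m (phi : fibering k m) (E E' : sgraph (k * m)) :
  E \subset E' -> respects M phi E' -> respects M phi E.
Proof.
move=> /fintype.subsetP sE /forallP H; apply/forallP => u; apply/forallP => v.
by apply/implyP => /sE uvE; have /forallP/(_ v)/implyP/(_ uvE) := H u.
Qed.

(** The noise model restricts added edges, the supremum all edges; the edges kept come from the lift
    and respect [M] already. *)
Lemma adversary_resp_admissible k (M : 'M[nat]_k) (lab : labelling k) (eps : R)
    (K : noise_kernel R k d) : mregular d M -> S_adv_resp M eps K ->
  admissible_kernel M lab eps (fun m x E' => respects M x.1 E') K.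
Proof.
move=> rM HK m x xs; have [K0 K1 Ks] := adversary_admissible HK xs.
split=> // E' /Ks /and3P[-> -> H] /=.
apply: respectsS (respectsU H (lift_graph_respects rM xs)).
by apply/fintype.subsetP => e; rewrite !inE orbC => ->; rewrite andbT orbN.
Qed.

Lemma lift_graph_bipartite k (M : 'M[nat]_k) (side : 'I_k -> bool) m
    (x : lift_config k d m) :
  mregular d M -> mbipartition M side ->
  x \in lift_space d M (sided_labelling side) m ->
  bipartite_by (left_half (k * m)) (lift_graph x).
Proof.
move=> rM bM xs; apply/forall_inP => e eE.
have [u [v [uv -> Muv _]]] := fiber_edge rM xs eE.
have := bM _ _ Muv; move: xs; rewrite inE => /and4P[_ /forallP Hl _ _].
rewrite (eqP (Hl u)) (eqP (Hl v)) => uvS.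
by rewrite card_set2I.
Qed.

(** On noisy lifts only the unflagged graphs are constrained, as flagging one is never an error
    there. *)
Definition testable k (M : 'M[nat]_k) (lab : labelling k)
    (space : forall n, {set sgraph n})
    (ok ok' : forall m, lift_config k d m -> pred (sgraph (k * m))) : Prop :=
  forall F q, poly_time F -> exists2 G, poly_time G &
    (forall n (E : sgraph n), E \in space n ->
       head false (G n E) = (ratr q < decode_num R (F n E))) /\
    (forall m (x : lift_config k d m) E', x \in lift_space d M lab m ->
       regular_graph d E' -> ok' m x E' -> ~~ head false (G (k * m)%N E') ->
       ok m x E' && (decode_num R (F (k * m)%N E') <= ratr q)).

Lemma no_certificate k (M : 'M[nat]_k) (lab : labelling k)
    (space : forall n, {set sgraph n})
    (ok ok' : forall m, lift_config k d m -> pred (sgraph (k * m))) (B c : R) :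
  (0 < k)%N -> B < c -> robustly_ge f M lab ok c ->
  testable M lab space ok ok' ->
  (forall eps, 0 < eps -> exists2 K, admissible_kernel M lab eps ok' K &
     ~ strong_detection (lift_sizes d M lab) (noisy_lift M lab K)
         (fun m => unif R (space (k * m)%N))) ->
  ~ certifiable d f space B.
Proof.
move=> k_gt0 ltBc rob test hard [F HF Hcert].
(* Robustness holds for all small noise levels; one positive level is fixed, and hardness is invoked
   at that level. *)
have [eps [eps_gt0 Heps]] := filter_ex (filterI (nbhs_right_gt 0) rob).
have [q] := rat_in_itvoo ltBc; rewrite in_itv /= => /andP[ltBq ltqc].
have [G HG [Hnull Hplanted]] := test F q HF.
have [K HK] := hard eps eps_gt0; apply; exists G; split=> //.
  exact: null_error k_gt0 ltBq Hcert Hnull.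
exact: planted_error ltqc Hcert.1 Heps HK Hplanted.
Qed.

Lemma threshold_test k (M : 'M[nat]_k) (lab : labelling k)
    (space : forall n, {set sgraph n})
    (ok : forall m, lift_config k d m -> pred (sgraph (k * m))) :
  (forall n (E : sgraph n), E \in space n -> regular_graph d E) ->
  testable M lab space ok ok.
Proof.
move=> Hspace F q HF; have [G HG EG] := poly_time_threshold R q HF.
exists G => //; split=> [n E /Hspace /andP[sE _]|m x E' _ /andP[sE _] -> ] /=.
  exact: EG.
by rewrite EG // -leNgt.
Qed.

(* The adversary may destroy bipartiteness, which [M_bi_sup] does not account
   for; but then the graph is recognisable as not coming from the null model. *)
Lemma bipartite_test k (M : 'M[nat]_k) (side : 'I_k -> bool) :
  mregular d M -> mbipartition M side ->
  testable M (sided_labelling side) (bipartite_regular_graphs d)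
    (fun m x E' => cobipartite (lift_graph x) E') (fun _ _ _ => true).
Proof.
move=> rM bM F q HF; have [G0 HG0 EG0] := poly_time_threshold R q HF.
have [G HG EG] := poly_time_bipartite_guard HG0.
exists G => //; split=> [n E|m x E' xs /andP[sE _] _].
  rewrite inE => /and3P[ev /andP[sE _] bE].
  by have := EG n E sE; rewrite ev bE => ->; apply: EG0.
have := EG _ E' sE; case: ifP => [/andP[_ bE] ->|_ ->] //.
rewrite EG0 // -leNgt => ->; rewrite andbT; apply/existsP.
exists (left_half (k * m)); rewrite bE andbT.
exact: lift_graph_bipartite rM bM xs.
Qed.

End Detection.

(** Subtracting [delta] makes the bound strict for a finite supremum; at +oo every real lies below,
    and at -oo the hypothesis fails. *)
Lemma lt_of_le_ereal_supB (R : realType) (S : set R) (B delta : R) : 0 < delta ->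
  (B%:E <= ereal_sup [set c%:E | c in S]%classic - delta%:E)%E ->
  exists2 c, S c & B < c.
Proof.
move=> delta_gt0 H.
suff /ereal_sup_gt[_ [c Sc <-]] : (B%:E < ereal_sup [set c%:E | c in S]%classic)%E.
  by rewrite lte_fin; exists c.
move: H; case: (ereal_sup _) => [r| |] H; [|by rewrite ltry|by []].
by move: H; rewrite -EFinB lee_fin lte_fin; lra.
Qed.

Theorem theorem4p2 (R : realType) (d : nat) (f : forall n : nat, sgraph n -> R)
    (delta : R) (hdelta : 0 < delta) :
  [/\ lift_conjecture (@S_rand R d) \/ lift_conjecture (@S_adv R d) ->
      forall B : R, (B%:E <= M_sup d f - delta%:E)%E ->
      ~ certifiable d f (regular_graphs d) B,
      lift_conjecture (@S_rand_resp R d) \/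
        lift_conjecture (@S_adv_resp R d) ->
      forall B : R, (B%:E <= M_resp_sup d f - delta%:E)%E ->
      ~ certifiable d f (regular_graphs d) B,
      lift_conjecture_bi (@S_rand_bi R d) \/ lift_conjecture_bi (@S_adv R d) ->
      forall B : R, (B%:E <= M_bi_sup d f - delta%:E)%E ->
      ~ certifiable d f (bipartite_regular_graphs d) B &
      lift_conjecture_bi (@S_rand_bi_resp R d) \/
        lift_conjecture_bi (@S_adv_resp R d) ->
      forall B : R, (B%:E <= M_bi_resp_sup d f - delta%:E)%E ->
      ~ certifiable d f (bipartite_regular_graphs d) B].
Proof.
have reg_space n (E : sgraph n) : E \in regular_graphs d n -> regular_graph d E.
  by rewrite inE.
have breg_space n (E : sgraph n) :
    E \in bipartite_regular_graphs d n -> regular_graph d E.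
  by rewrite inE => /and3P[].
split=> conj B HB.
- have [c [k [M [rM rob]]] ltBc] := lt_of_le_ereal_supB hdelta HB.
  have [k_gt1 regM _] := rM.
  apply: (no_certificate (ltnW k_gt1) ltBc rob (threshold_test _ _ _ _ reg_space)) => eps eps_gt0.
  case: conj => H; have [K HK hK] := H k M rM eps eps_gt0; exists K => //.
    by rewrite HK; apply: random_kernel_admissible => //; apply: ltW.
  exact: adversary_admissible.
- have [c [k [M [rM rob]]] ltBc] := lt_of_le_ereal_supB hdelta HB.
  have [k_gt1 regM _] := rM.
  apply: (no_certificate (ltnW k_gt1) ltBc rob (threshold_test _ _ _ _ reg_space)) => eps eps_gt0.
  case: conj => H; have [K HK hK] := H k M rM eps eps_gt0; exists K => //.
    rewrite HK; apply: random_kernel_admissible; first exact: ltW.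
    move=> m x D A xs okA; apply: respectsU okA.
    exact: respectsS (finset.subsetDl _ _) (lift_graph_respects regM xs).
  exact: adversary_resp_admissible.
- have [c [k [M [side [rM rob]]]] ltBc] := lt_of_le_ereal_supB hdelta HB.
  have [k_gt1 regM bipM _] := rM.
  apply: (no_certificate (ltnW k_gt1) ltBc rob (bipartite_test R regM bipM)) => eps eps_gt0.
  case: conj => H; have [K HK hK] := H k M side rM eps eps_gt0; exists K => //.
    by rewrite HK; apply: random_kernel_admissible => //; apply: ltW.
  exact: adversary_admissible.
- have [c [k [M [side [rM rob]]]] ltBc] := lt_of_le_ereal_supB hdelta HB.
  have [k_gt1 regM bipM _] := rM.
  (* This supremum ranges over graphs respecting [M], which is what both noise models guarantee, so
     the threshold alone is the test. *)
  apply: (no_certificate (ltnW k_gt1) ltBc rob (threshold_test _ _ _ _ breg_space)) => eps eps_gt0.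
  case: conj => H; have [K HK hK] := H k M side rM eps eps_gt0; exists K => //.
    rewrite HK; apply: random_kernel_admissible; first exact: ltW.
    move=> m x D A xs /andP[_ okA]; apply: respectsU okA.
    exact: respectsS (finset.subsetDl _ _) (lift_graph_respects regM xs).
  exact: adversary_resp_admissible.
Qed.
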